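(* Let $\Omega\subset\mathbb{R}^n$ be an open set, let $d$ be a metric induced by a norm on $\mathbb{R}^n$, and let $w\in L^1_{loc}(\Omega)$, $w>0$ a.e. in $\Omega$, be a weight with $w\in W^{1,p}_{loc}(\Omega)\cap L^\infty_{loc}(\Omega)$ for some $1<p<\infty$. Then $$\mathcal{H}(\Omega,d,w\,dx)\subset W^{1,p}_{loc}(\Omega).$$
   Context: A metric $d$ is norm induced if $d(x,y)=\|x-y\|$ for a norm $\|\cdot\|$ on $\mathbb{R}^n$ (not necessarily Euclidean). $B(x,r)=\{y\in\mathbb{R}^n: d(x,y)<r\}$. For a measure $d\mu=w\,dx$ on $\Omega$, a locally integrable function $u:\Omega\to\mathbb{R}$ is called strongly harmonic in $\Omega$ if for every ball $B(x,r)$ with $B(x,r)\Subset\Omega$ (closure compact and contained in $\Omega$) there holds $$u(x)=\frac{1}{\mu(B(x,r))}\int_{B(x,r)}u(y)\,d\mu(y),\qquad \mu(B(x,r))=\int_{B(x,r)}w\,dx.$$ The set of all such functions is denoted $\mathcal{H}(\Omega,d,w\,dx)$. *)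

(* Defs.v *)
From HB Require Import structures.
From mathcomp Require Import all_boot all_order all_algebra.
From mathcomp Require Import all_classical all_reals all_analysis.

Set Implicit Arguments.
Unset Strict Implicit.
Unset Printing Implicit Defensive.
Import Order.TTheory GRing.Theory Num.Theory.
Import numFieldNormedType.Exports.
Local Open Scope classical_set_scope.
Local Open Scope ring_scope.

Section row_vector_measurable.
Context {d : measure_display} {T : measurableType d} (n : nat).

Let coord (i : 'I_n) (x : 'rV[T]_n) : T := x ord0 i.

Let rV_set0 : g_sigma_preimage coord set0.
Proof. exact: sigma_algebra0. Qed.

Let rV_setC A : g_sigma_preimage coord A -> g_sigma_preimage coord (~` A).
Proof. exact: sigma_algebraC. Qed.

Let rV_bigcup (F : (set 'rV[T]_n)^nat) :
  (forall i, g_sigma_preimage coord (F i)) ->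
  g_sigma_preimage coord (\bigcup_i (F i)).
Proof. exact: sigma_algebra_bigcup. Qed.

(* The sigma-algebra generated by the coordinates, as the library does for
   tuples; for T := R it is the Borel sigma-algebra of R^n. *)
HB.instance Definition _ := @isMeasurable.Build (measure_tuple_display d)
  'rV[T]_n (g_sigma_preimage coord) rV_set0 rV_setC rV_bigcup.

Lemma measurable_coord (i : 'I_n) :
  measurable_fun [set: 'rV[T]_n] (fun x => x ord0 i).
Proof.
move=> _ Y mY; rewrite setTI; apply: sub_sigma_algebra => /=.
rewrite -bigcup_seq/=; exists i => /=; first by rewrite mem_index_enum.
by exists Y => //; rewrite setTI.
Qed.

Lemma measurable_fun_rV d' (T' : measurableType d') (f : T' -> 'rV[T]_n) :
  (forall i, measurable_fun [set: T'] (fun x => f x ord0 i)) ->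
  measurable_fun [set: T'] f.
Proof.
move=> mf.
have : g_sigma_preimage (fun i => coord i \o f) `<=` measurable.
  apply: smallest_sub; first exact: sigma_algebra_measurable.
  rewrite -bigcup_seq; apply: bigcup_sub => i _.
  by move=> A [B mB <-]; exact: mf.
rewrite g_sigma_preimage_comp => prefS _ A mA.
by apply: prefS; exists A.
Qed.

End row_vector_measurable.

Section lebesgue_measure_rV.
Context {R : realType}.

Definition cons_rV n (vx : 'rV[R]_n * R) : 'rV[R]_n.+1 :=
  \row_i oapp (vx.1 ord0) vx.2 (unlift ord0 i).

Lemma measurable_cons_rV n :
  measurable_fun [set: 'rV[R]_n * measurableTypeR R] (@cons_rV n).
Proof.
apply: measurable_fun_rV => i.
under eq_fun do rewrite mxE.
case: unliftP => [j _|_] /=; last exact: measurable_snd.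
exact: (measurableT_comp (measurable_coord j) measurable_fst).
Qed.

Definition borel_lebesgue_rVS n (mu : {measure set 'rV[R]_n -> \bar R}) :
    {measure set 'rV[R]_n.+1 -> \bar R} :=
  measure_function_pushforward__canonical__measure_function_Measure
    (mu \x lebesgue_measure)%E (@measurable_cons_rV n).

(* The n-fold product of the Lebesgue measure of R, on Borel sets. *)
Fixpoint borel_lebesgue_rV n : {measure set 'rV[R]_n -> \bar R} :=
  if n is m.+1 then borel_lebesgue_rVS (borel_lebesgue_rV m)
  else \d_ (0 : 'rV[R]_0).

(* A copy of R^n carrying the Lebesgue-measurable sets. *)
Definition lebesgue_rV_type n :=
  caratheodory_type ((borel_lebesgue_rV n)^*)%mu.

Definition lebesgue_rV n : {measure set (lebesgue_rV_type n) -> \bar R} :=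
  @completed_measure_extension _ _ _ (borel_lebesgue_rV n).

End lebesgue_measure_rV.
Arguments lebesgue_rV_type : clear implicits.
Arguments lebesgue_rV R n : clear implicits.

Section function_spaces.
Context {R : realType} {n : nat}.
Local Notation E := 'rV[R]_n.
Local Notation leb := (lebesgue_rV R n).
Local Notation L := (lebesgue_rV_type R n).
Implicit Types (Om V : set E) (f g phi : E -> R).

Definition compactly_included (V Om : set E) : Prop :=
  compact (closure V) /\ closure V `<=` Om.

Definition locally_integrable_on (mu : set L -> \bar R) Om f : Prop :=
  measurable_fun (Om : set L) (f : L -> R) /\
  forall K : set E, compact K -> K `<=` Om ->
    mu.-integrable (K : set L) (EFin \o (f : L -> R)).

(* [Lnorm] is taken over the whole space, hence the extension of f by 0. *)
Definition in_Lp (p : \bar R) Om f : Prop :=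
  measurable_fun (Om : set L) (f : L -> R) /\
  ('N[leb]_p [EFin \o ((f : L -> R) \_ (Om : set L))] < +oo)%E.

Definition in_Lp_loc (p : \bar R) Om f : Prop :=
  forall K : set E, compact K -> K `<=` Om -> in_Lp p K f.

Definition partial (i : 'I_n) f : E -> R := fun x => 'D_(delta_mx ord0 i) f x.

(* All iterated partial derivatives exist and are continuous. *)
Definition smooth f : Prop := forall s : seq 'I_n,
  continuous (foldr partial f s) /\
  forall i x, derivable (foldr partial f s) x (delta_mx ord0 i).

(* The closure in [compactly_included] is here the support of phi. *)
Definition test_function Om phi : Prop :=
  smooth phi /\ compactly_included [set x | phi x != 0] Om.

Definition weak_partial (i : 'I_n) Om f g : Prop :=
  forall phi, test_function Om phi ->
    \int[leb]_(x in (Om : set L)) (f x * partial i phi x) =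
    - \int[leb]_(x in (Om : set L)) (g x * phi x).

Definition in_W1p (p : \bar R) Om f : Prop :=
  in_Lp p Om f /\
  forall i, exists2 g, in_Lp p Om g & weak_partial i Om f g.

Definition in_W1p_loc (p : \bar R) Om f : Prop :=
  forall V, open V -> compactly_included V Om -> in_W1p p V f.

End function_spaces.

Section strongly_harmonic.
Context {R : realType} {n : nat}.
Local Notation E := 'rV[R]_n.
Local Notation L := (lebesgue_rV_type R n).

Definition is_norm (N : E -> R) : Prop :=
  [/\ forall x, N x = 0 -> x = 0,
      forall a x, N (a *: x) = `|a| * N x &
      forall x y, N (x + y) <= N x + N y].

Definition norm_induced (d : E -> E -> R) : Prop :=
  exists2 N, is_norm N & forall x y, d x y = N (x - y).

Definition mball (d : E -> E -> R) (x : E) (r : R) : set E :=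
  [set y | d x y < r].

(* The measure w dx on Om, as a set function on Lebesgue-measurable sets; it
   is a measure when w is measurable on Om and w >= 0 a.e. in Om. *)
Definition weighted (w : E -> R) (Om : set E) (A : set L) : \bar R :=
  (\int[lebesgue_rV R n]_(x in A `&` (Om : set L)) (w x)%:E)%E.

Definition strongly_harmonic (Om : set E) (d : E -> E -> R) (w : E -> R) :
    set (E -> R) :=
  [set u | locally_integrable_on (weighted w Om) Om u /\
    forall x r, 0 < r -> compactly_included (mball d x r) Om ->
      (u x)%:E = ((weighted w Om (mball d x r))^-1 *
        \int[weighted w Om]_(y in (mball d x r : set L)) (u y)%:E)%E].

End strongly_harmonic.

(* Main.v *)
(* A strongly harmonic function u satisfies u(x) m(B(x,r)) = int_{B(x,r)} u dm
   with dm = w dx.  First u is locally bounded, since m(B(x,r)) is locally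
   bounded away from 0.  As w is locally bounded, both int_{B(x,r)} u dm and
   m(B(x,r)) then vary at most like the Lebesgue measure of the symmetric
   difference of two balls, which is O(N(x - y)); so u is locally Lipschitz.
   The difference quotients of u in a coordinate direction are thus bounded on
   V; a weak-* cluster point of them is a bounded weak partial derivative.  It
   is obtained as the Radon-Nikodym density of the limit of their integrals
   along an ultrafilter, and discrete integration by parts (translation
   invariance of the Lebesgue measure) identifies it. *)
Require Import Defs.
From HB Require Import structures.
From mathcomp Require Import all_boot all_order all_algebra.
From mathcomp Require Import all_classical all_reals all_analysis.
From mathcomp Require Import measurable_realfun ess_sup_inf ring lra.
Set Implicit Arguments.
Unset Strict Implicit.
Unset Printing Implicit Defensive.
Import Order.TTheory GRing.Theory Num.Theory.
Import numFieldNormedType.Exports.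
Local Open Scope classical_set_scope.
Local Open Scope ring_scope.

(** * Lebesgue measure on R^n *)

Section translation_invariance.
Context {R : realType}.
Local Notation MR := (measurableTypeR R).

(** The weak derivative is obtained from a nonnegative measure, not a signed one: the difference
    quotients, bounded by [M], are raised by [M] into [0, 2M], and the shift is subtracted after the
    limit. Along an ultrafilter the integrals over all measurable sets converge simultaneously,
    without extracting a subsequence; domination by 2M times the base measure turns the finitely
    additive limit into a countably additive, absolutely continuous one. When the integrals against
    a test function also converge in the ordinary sense, both limits agree, so the ultrafilter
    leaves no trace in the result. A second obstacle is that [weighted w Om] is only a set function,
    since [w] may be negative on a null set. It is traded for the measure with density the positive
    part of [w], extended by 0: the two agree on measurable sets, the only ones that [integral]
    evaluates. Membership in L^p, for [u] and its weak derivatives alike, comes from boundedness on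
    a set of finite measure. *)

Lemma measurable_shiftR (h : R) : measurable_fun setT (fun x : MR => (x + h : MR)).
Proof. exact: measurable_funD. Qed.

(** Half-open intervals determine Lebesgue measure, and on them its pushforward by the shift takes
    the same values. *)
Lemma lebesgue_measure_shift (h : R) (A : set MR) : measurable A ->
  lebesgue_measure ((fun x : MR => (x + h : MR)) @^-1` A) = lebesgue_measure A.
Proof.
move=> mA; apply/esym.
apply: (@lebesgue_measure_unique _
  (measure_function_pushforward__canonical__measure_function_Measure
    lebesgue_measure (measurable_shiftR h))) => //= _ [[a b]] _ <- /=.
rewrite /pushforward.
rewrite [X in _ = lebesgue_measure X](_ : _ = `]a - h, b - h]%classic).
  by rewrite !lebesgue_measure_itv/= !lte_fin ltrBlDr subrK -!EFinB opprB addrA subrK.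
by apply/seteqP; split=> x /=; rewrite !in_itv/= ltrBlDr lerBrDr.
Qed.

Definition translate n (h x : 'rV[R]_n) : 'rV[R]_n := x + h.

Lemma measurable_translate n (h : 'rV[R]_n) :
  measurable_fun [set: 'rV[R]_n] (translate h : 'rV[R]_n -> 'rV[R]_n).
Proof.
apply: measurable_fun_rV => i; rewrite /translate.
under eq_fun do rewrite mxE.
apply: measurable_funD => //.
exact: measurable_coord.
Qed.

Definition tail_rV n (h : 'rV[R]_n.+1) : 'rV[R]_n := \row_j h ord0 (lift ord0 j).

(** Through [cons_rV] a translation splits into one of the tail and one of the scalar at index 0,
    which allows invariance to be proved by induction on the dimension. *)
Lemma cons_rVD n (v : 'rV[R]_n) (x : R) (h : 'rV[R]_n.+1) :
  cons_rV (v, x) + h = cons_rV (v + tail_rV h, x + h ord0 ord0).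
Proof.
apply/rowP => i; rewrite !mxE; case: unliftP => [j ->|->] /=; last by [].
by rewrite !mxE.
Qed.

(** Induction on [n] by sections: a section of the translated set is a shift of the section of [A]
    over the translated tail. The one-dimensional case treats the inner measure, the induction
    hypothesis the outer integral. *)
Lemma borel_lebesgue_translate n (h : 'rV[R]_n) (A : set 'rV[R]_n) : measurable A ->
  borel_lebesgue_rV n (translate h @^-1` A) =
  borel_lebesgue_rV n A.
Proof.
elim: n h A => [|n ih] h A mA.
  by congr (borel_lebesgue_rV 0 _); apply/seteqP; split=> x /=;
   rewrite (_ : translate h x = x)//; apply/rowP; case.
rewrite /= /pushforward /= /product_measure1.
pose g (v : 'rV[R]_n) := lebesgue_measure (xsection (@cons_rV R n @^-1` A) v).
have mcA : measurable (@cons_rV R n @^-1` A).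
  by have := measurable_cons_rV measurableT mA; rewrite setTI.
have mg : measurable_fun setT g by exact: measurable_fun_xsection.
transitivity (\int[borel_lebesgue_rV n]_v g (translate (tail_rV h) v))%E.
  apply: eq_integral => v _ /=; rewrite /g.
  rewrite -[RHS](lebesgue_measure_shift (h ord0 ord0)); last exact: measurable_xsection.
  by congr lebesgue_measure; apply/seteqP; split => x;
    rewrite /xsection /= !inE /= /translate cons_rVD.
have -> : (\int[borel_lebesgue_rV n]_v g (translate (tail_rV h) v) =
   \int[pushforward (borel_lebesgue_rV n)
      (translate (tail_rV h) : 'rV[R]_n -> 'rV[R]_n)]_v g v)%E.
  by apply: esym; apply: (ge0_integral_pushforward (measurable_translate (tail_rV h))
    (borel_lebesgue_rV n) measurableT mg).
apply: (eq_measure_integral (borel_lebesgue_rV n)) => [|? B mB _].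
  exact: measurable_translate.
exact: ih.
Qed.

(** * Boxes, balls and Borel measurability of open sets *)

Definition box n (c : 'rV[R]_n) (e : R) : set 'rV[R]_n :=
  [set x | forall i, x ord0 i \in `]c ord0 i - e, c ord0 i + e[].

Lemma measurable_box n (c : 'rV[R]_n) e : measurable (box c e : set 'rV[R]_n).
Proof.
rewrite (_ : box c e = \bigcap_(i in [set: 'I_n])
   ((fun x : 'rV[R]_n => x ord0 i) @^-1` `]c ord0 i - e, c ord0 i + e[)).
  apply: (@fin_bigcap_measurable _ _ 'I_n) => [|i _]; first exact: finite_finset.
  rewrite -[X in measurable X]setTI; apply: measurable_coord => //.
by apply/seteqP; split => x /= xb i //=; exact: xb.
Qed.

Lemma borel_lebesgue_box n (c : 'rV[R]_n) e : 0 < e ->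
  borel_lebesgue_rV n (box c e) = (((2 * e) ^+ n)%:E)%E.
Proof.
move=> e0; elim: n c => [|n ih] c.
  by rewrite /= diracE expr0 mem_set// => -[].
rewrite /= /pushforward (_ : _ @^-1` _ =
    box (tail_rV c) e `*` `]c ord0 ord0 - e, c ord0 ord0 + e[%classic).
  rewrite product_measure1E/=; [|exact: measurable_box|exact: measurable_itv].
  rewrite ih lebesgue_measure_itv/= lte_fin ltrBlDr -addrA ltrDl addr_gt0//.
  rewrite -EFinB -EFinM exprSr; congr (_ * _)%:E.
  by rewrite opprB addrACA addrC addrA subrK mulrDl mul1r.
apply/seteqP; split => -[v x] /=.
  move=> b; split => [i|].
    by have := b (lift ord0 i); rewrite !mxE liftK.
  by have := b ord0; rewrite !mxE unlift_none.
move=> [b1 b2] i; rewrite !mxE; case: unliftP => [j ->|->] //=.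
by have := b1 j; rewrite !mxE.
Qed.

(** [ball] on matrices contains [0 < e] as a conjunct, whereas in dimension 0 a [box] is the whole
    space for every [e]; hence the hypothesis. *)
Lemma ball_box n (c : 'rV[R]_n) e : 0 < e -> ball c e = box c e.
Proof.
move=> e0; apply/seteqP; split => x.
  by move=> [_ b] i; have := b ord0 i; rewrite /ball/= in_itv/= ltr_distlC.
move=> b; split => // i j; rewrite ord1.
by have := b j; rewrite /ball/= in_itv/= ltr_distlC.
Qed.

Lemma measurable_ball_rV n (c : 'rV[R]_n) e : measurable (ball c e : set 'rV[R]_n).
Proof.
have [e0|e0] := ltP 0 e; first by rewrite ball_box//; exact: measurable_box.
rewrite (_ : ball c e = set0)//; apply/seteqP; split => x //= [].
by rewrite ltNge e0.
Qed.

(** The sigma-algebra is generated by coordinates, not by open sets; the link is that [U] is the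
    countable union of the balls inside it with rational centre and radius 1/(k+1), and these are
    boxes. *)
Lemma open_measurable_rV n (U : set 'rV[R]_n) : open U -> measurable U.
Proof.
move=> oU.
pose I := ('rV[rat]_n * nat)%type.
pose ctr (i : I) : 'rV[R]_n := \row_j ratr (i.1 ord0 j).
pose F (i : I) : set 'rV[R]_n := if `[< ball (ctr i) i.2.+1%:R^-1 `<=` U >]
  then ball (ctr i) i.2.+1%:R^-1 else set0.
rewrite (_ : U = \bigcup_i F i); last first.
  apply/seteqP; split => x; last first.
    by move=> [i _]; rewrite /F; case: asboolP => // BU; exact: BU.
  move=> Ux; have /nbhs_ballP[e /= e0 eU] : nbhs x U by exact: open_nbhs_nbhs.
  (* The centre will lie within one radius of [x], so a radius below [e / 2] keeps the rational ball
     inside [ball x e]. *)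
  have [k ke] : exists k, k.+1%:R^-1 < e / 2 :> R.
    have [k _ /(_ _ (leqnn _)) h] := near_infty_natSinv_lt (PosNum (divr_gt0 e0 (ltr0n R 2))).
    by exists k.
  have k0 : 0 < k.+1%:R^-1 :> R by rewrite invr_gt0.
  have /choice[q hq] : forall j : 'I_n, exists q : rat, `|x ord0 j - ratr q| < k.+1%:R^-1.
    move=> j; have [q] := rat_in_itvoo (ltr_pwDr k0 (lexx (x ord0 j))).
    rewrite in_itv/= => /andP[q1 q2]; exists q.
    by rewrite ltr_distlC (lt_trans _ q1) ?q2// gtrBl.
  exists (\row_j q j, k) => //; rewrite /F /=; case: asboolP => [_|].
    split => // i j; rewrite ord1 !mxE /ball /= distrC; exact: hq.
  move=> []; apply: subset_trans eU => y [_ b].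
  split => // i j; have := b i j; rewrite ord1 !mxE /ball/= => bb.
  rewrite -(subrK (ratr (q j)) (x ord0 j)) -addrA (le_lt_trans (ler_normD _ _))//.
  by rewrite (splitr e) ltrD// (lt_trans _ ke).
apply: countable_bigcupT_measurable => [|i]; [exact: countableP|rewrite /F].
by case: asboolP => // _; exact: measurable_ball_rV.
Qed.

Local Notation L n := (lebesgue_rV_type R n).
Local Notation leb n := (lebesgue_rV R n).

Lemma borel_lebesgue_measurable n (A : set 'rV[R]_n) :
  measurable A -> measurable (A : set (L n)).
Proof. by move=> mA; exact: caratheodory_measurable_mu_ext. Qed.

Lemma lebesgue_rVE n (A : set 'rV[R]_n) :
  measurable A -> leb n A = borel_lebesgue_rV n A.
Proof. by move=> mA; rewrite /= /completed_measure_extension measurable_mu_extE. Qed.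

Lemma open_lebesgue_measurable n (U : set 'rV[R]_n) : open U -> measurable (U : set (L n)).
Proof. by move=> /open_measurable_rV/borel_lebesgue_measurable. Qed.

Lemma closed_lebesgue_measurable n (U : set 'rV[R]_n) : closed U -> measurable (U : set (L n)).
Proof.
move=> cU; rewrite -[U]setCK; apply: (@measurableC _ (L n)).
by apply: open_lebesgue_measurable; exact: closed_openC.
Qed.

Lemma lebesgue_ball n (c : 'rV[R]_n) e : 0 < e -> leb n (ball c e) = ((2 * e) ^+ n)%:E.
Proof.
move=> e0; rewrite lebesgue_rVE; last exact: measurable_ball_rV.
by rewrite ball_box// borel_lebesgue_box.
Qed.

Lemma open_lebesgue_gt0 n (U : set 'rV[R]_n) : open U -> U !=set0 -> (0 < leb n U)%E.
Proof.
move=> oU [x Ux]; have /nbhs_ballP[e /= e0 eU] : nbhs x U by exact: open_nbhs_nbhs.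
apply: (@lt_le_trans _ _ (leb n (ball x e))).
  by rewrite lebesgue_ball// lte_fin exprn_gt0// mulr_gt0.
apply: le_measure => //; rewrite inE; apply: borel_lebesgue_measurable.
  exact: measurable_ball_rV.
exact: open_measurable_rV.
Qed.

Lemma bounded_lebesgue_lty n (A : set 'rV[R]_n) : measurable (A : set (L n)) ->
  bounded_set A -> (leb n A < +oo)%E.
Proof.
move=> mA [M [_ /(_ (`|M| + 1))]]; rewrite (le_lt_trans (ler_norm M)) ?ltrDl// => /(_ erefl) hM.
have M0 : 0 < `|M| + 2 by rewrite ltr_wpDl.
apply: (@le_lt_trans _ _ (leb n (ball 0 (`|M| + 2)))); last by rewrite lebesgue_ball// ltry.
apply: le_measure; rewrite ?inE//.
  by apply: borel_lebesgue_measurable; exact: measurable_ball_rV.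
move=> x /hM xM; rewrite mx_norm_ball /ball_/= sub0r normrN (le_lt_trans xM)//.
by rewrite ltrD2l ltr1n.
Qed.

Lemma compact_lebesgue_lty n (A : set 'rV[R]_n) : compact A -> (leb n A < +oo)%E.
Proof.
move=> cA; apply: bounded_lebesgue_lty; last exact: compact_bounded.
by apply: closed_lebesgue_measurable; apply: compact_closed => //; exact: norm_hausdorff.
Qed.

(** Translating a Borel cover of a set gives a cover of the translated set with the same total
    measure; the reverse inequality is the same one for [- h]. This holds for arbitrary sets, which
    the Carathéodory condition will require. *)
Lemma mu_ext_translate n (h : 'rV[R]_n) (A : set 'rV[R]_n) :
  ((borel_lebesgue_rV n)^*%mu (translate h @^-1` A) = (borel_lebesgue_rV n)^*%mu A)%E.
Proof.
have le h' (B : set 'rV[R]_n) :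
    ((borel_lebesgue_rV n)^*%mu (translate h' @^-1` B) <= (borel_lebesgue_rV n)^*%mu B)%E.
  apply: le_ereal_inf_tmp => _ [F [mF BF] <-].
  apply: ereal_inf_lbound; exists (fun k => translate h' @^-1` F k).
    split => [k|].
      by have := measurable_translate h' measurableT (mF k); rewrite setTI.
    by rewrite -preimage_bigcup; exact: preimage_subset.
  by apply: eq_eseriesr => k _; rewrite borel_lebesgue_translate.
apply/eqP; rewrite eq_le le/=.
have := le (- h) (translate h @^-1` A).
rewrite -comp_preimage (_ : _ \o _ = id)//; apply/funext => x.
by rewrite /translate /= subrK.
Qed.

(** Lebesgue-measurable sets need not be Borel, so the Carathéodory condition itself is transported:
    each of its three outer measures is translation invariant. *)
Lemma measurable_preimage_translate n (h : 'rV[R]_n) (A : set 'rV[R]_n) :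
  measurable (A : set (L n)) -> measurable (translate h @^-1` A : set (L n)).
Proof.
move=> mA.
have {}mA : caratheodory_measurable ((borel_lebesgue_rV n)^*)%mu A by exact: mA.
suff : caratheodory_measurable ((borel_lebesgue_rV n)^*)%mu (translate h @^-1` A) by [].
move=> X; rewrite -(mu_ext_translate (- h) X) (mA _).
rewrite -(mu_ext_translate h (_ `&` A)) -(mu_ext_translate h (_ `&` ~` A)).
have E x : translate (- h) (translate h x) = x by rewrite /translate addrK.
congr (_ + _)%E; congr (((borel_lebesgue_rV n)^*)%mu _);
  by apply/seteqP; split => x /=; rewrite E.
Qed.

Lemma measurable_fun_translate n (h : 'rV[R]_n) :
  measurable_fun setT (translate h : L n -> L n).
Proof. by move=> _ A mA; rewrite setTI; exact: measurable_preimage_translate. Qed.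

Lemma lebesgue_translate n (h : 'rV[R]_n) (A : set 'rV[R]_n) :
  leb n (translate h @^-1` A) = leb n A.
Proof. exact: mu_ext_translate. Qed.

Lemma ge0_integral_translate n (h : 'rV[R]_n) (f : L n -> \bar R) :
  measurable_fun setT f -> (forall x, 0 <= f x)%E ->
  (\int[leb n]_x f (translate h x) = \int[leb n]_x f x)%E.
Proof.
move=> mf f0; have mh := @measurable_fun_translate n h.
transitivity (\int[pushforward (leb n) (translate h : L n -> L n)]_x f x)%E.
  by apply: esym; exact: (ge0_integral_pushforward mh (leb n) measurableT mf).
apply: (eq_measure_integral (leb n)) => A mA _.
exact: lebesgue_translate.
Qed.

Lemma integral_translate n (h : 'rV[R]_n) (f : L n -> \bar R) :
  measurable_fun setT f ->
  (\int[leb n]_x f (translate h x) = \int[leb n]_x f x)%E.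
Proof.
move=> mf.
have Ep := ge0_integral_translate h (measurable_funepos mf) (funepos_ge0 f).
have En := ge0_integral_translate h (measurable_funeneg mf) (funeneg_ge0 f).
rewrite integralE [RHS]integralE; congr (_ - _)%E.
  by rewrite -Ep; apply: eq_integral => x _; rewrite !funeposE.
by rewrite -En; apply: eq_integral => x _; rewrite !funenegE.
Qed.

End translation_invariance.

(** * Weak limits of bounded densities *)

Section bounded_integrals.
Context d (T : measurableType d) (R : realType) (mu : {measure set T -> \bar R}).
Local Open Scope ereal_scope.

Lemma bounded_integrable (A : set T) (f : T -> R) (C : R) :
  measurable A -> mu A < +oo -> measurable_fun A f ->
  (forall x, A x -> (`|f x| <= C)%R) -> mu.-integrable A (EFin \o f).
Proof.
move=> mA Afin mf fC; apply: measurable_bounded_integrable => //.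
exists C; split; first exact: num_real.
by move=> x Cx y Ay; apply: (le_trans (fC _ Ay)); exact: ltW.
Qed.

Lemma le_Rintegral_bound (A : set T) (f : T -> R) (C : R) :
  measurable A -> mu A < +oo -> measurable_fun A f ->
  (forall x, A x -> (`|f x| <= C)%R) ->
  (`| \int[mu]_(x in A) f x | <= C * fine (mu A))%R.
Proof.
move=> mA Afin mf fC.
have intf := bounded_integrable mA Afin mf fC.
apply: le_trans (le_normr_Rintegral mA intf) _.
rewrite -Rintegral_cst//; apply: le_Rintegral => //.
- exact: integrable_norm.
- by apply: (@bounded_integrable A (cst C) `|C|).
Qed.

End bounded_integrals.

(** * Radon-Nikodym densities of dominated measures *)

Section bounded_density.
Context d (T : measurableType d) (R : realType)
  (mu : {sigma_finite_measure set T -> \bar R})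
  (nu : {finite_measure set T -> \bar R}) (C : R).
Hypothesis C0 : (0 <= C)%R.
Hypothesis nuC : forall A, measurable A -> (nu A <= C%:E * mu A)%E.
Local Open Scope ereal_scope.

(** Domination bounds the Radon-Nikodym density [f] by [C] only almost everywhere; truncating it at
    [C] gives a bound at every point without changing any integral. *)
Lemma bounded_radon_nikodym : exists F : T -> R,
  [/\ measurable_fun setT F, forall x, (0 <= F x <= C)%R &
      forall A, measurable A -> nu A = \int[mu]_(x in A) (F x)%:E].
Proof.
have numu : nu `<< mu.
  apply/null_content_dominatesP => A mA muA0; apply/eqP.
  by rewrite eq_le measure_ge0 andbT (le_trans (nuC mA))// muA0 mule0.
have [f [f0 ffin intf nuf]] := radon_nikodym_sigma_finite numu.
have mf : measurable_fun setT f by case/integrableP : intf.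
pose F x := Order.min (fine (f x)) C.
have mF : measurable_fun setT F.
  apply: measurable_minr => //; exact: measurableT_comp.
have F0C x : (0 <= F x <= C)%R by rewrite le_min fine_ge0//= C0 ge_min lexx orbT.
have mFE A : measurable_fun A (EFin \o F).
  by apply/measurable_EFinP; exact: measurable_funTS.
have mfA A : measurable_fun A f by exact: measurable_funTS.
have F0 A x : A x -> 0 <= (EFin \o F) x by move=> _; rewrite lee_fin; case/andP: (F0C x).
exists F; split => // A mA.
pose G := A `&` [set x | f x <= C%:E]; pose H := A `\` [set x | f x <= C%:E].
have mS : measurable [set x | f x <= C%:E].
  by rewrite -[X in measurable X]setTI; exact: emeasurable_fun_le.
have mG : measurable G by exact: measurableI.
have mH : measurable H by exact: measurableD.
have EA : A = G `|` H by rewrite setUIDK.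
have GH : [disjoint G & H].
  by apply/disj_setPS => x [[_ ?] [_]].
rewrite EA measureU//; last by apply/eqP; rewrite -disj_set2E.
rewrite ge0_integral_setU//; last first.
  exact: F0.
congr (_ + _).
  apply: eq_trans (nuf _ mG) _; apply: eq_integral => x; rewrite inE => -[_ /= fC].
  by rewrite /F min_l ?fineK// -lee_fin fineK.
(* On [H], where [f] exceeds [C], the chain nu H <= C mu H = int F <= int f = nu H closes up. *)
apply/eqP; rewrite eq_le; apply/andP; split.
  apply: (le_trans (nuC mH)); rewrite -integral_cst//; apply: ge0_le_integral => //.
  move=> x [_ /= /negP]; rewrite -ltNge => fC; rewrite lee_fin /F min_r//.
    by rewrite -lee_fin fineK// ltW.
apply: (@le_trans _ _ (\int[mu]_(x in H) f x)); last by rewrite le_eqVlt -(nuf _ mH) eqxx.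
apply: ge0_le_integral => //.
- exact: F0.
- by move=> x _; rewrite -[leRHS]fineK// lee_fin /F ge_min lexx.
Qed.

End bounded_density.

(** The image of an ultrafilter is an ultrafilter, and those on the compact interval [-C, C]
    converge. *)
Lemma ultrafilter_cvg (R : realType) (U : set_system nat) (a : nat -> R) (C : R) :
  UltraFilter U -> (forall k, `|a k| <= C) -> a @ U --> lim (a @ U).
Proof.
move=> UU aC.
have : compact `[-C, C]%classic by exact: segment_compact.
rewrite compact_ultra => /(_ (a @ U)).
have aU : UltraFilter (a @ U).
  split; first exact: fmap_proper_filter.
  move=> G FG aG; apply/seteqP; split=> // A GA.
  have [//|UA] := in_ultra_setVsetC (a @^-1` A) UU.
  exfalso; have := @filterI _ G (@filter_filter _ _ FG) _ _ GA (aG (~` A) UA).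
  by rewrite setICr => /filter_not_empty.
move=> /(_ aU) [].
  apply: (@filterS _ U _ setT) => [k _|]; last exact: filterT.
  by rewrite /= in_itv/= -ler_norml.
by move=> l [_ al]; have /cvgP := al.
Qed.

(** * Ultrafilter limits of uniformly bounded densities *)

Section weak_sequential_limit.
Context d (T : measurableType d) (R : realType)
  (mu : {sigma_finite_measure set T -> \bar R}) (V : set T) (C : R)
  (D : nat -> T -> R).
Hypothesis mV : measurable V.
Hypothesis muV : (mu V < +oo)%E.
Hypothesis C0 : 0 <= C.
Hypothesis mD : forall k, measurable_fun V (D k).
Hypothesis D0C : forall k x, V x -> 0 <= D k x <= C.
Variable U : set_system nat.
Hypothesis UU : UltraFilter U.

Let muVI A : measurable A -> (mu (V `&` A) < +oo)%E.
Proof.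
move=> mA; apply: le_lt_trans muV.
by apply: le_measure; rewrite ?inE//; exact: measurableI.
Qed.

Let mDI k A : measurable_fun (V `&` A) (D k).
Proof. by apply: measurable_funS (mD k) => // x []. Qed.

Let D_C k x : V x -> `|D k x| <= C.
Proof. by move=> /(D0C k)/andP[D0 DC]; rewrite ger0_norm. Qed.

(* Countably additive because it is finitely additive and bounded by
   [C * mu (V `&` A)]. *)
Definition weak_lim_content (A : set T) : R :=
  lim ((fun k => \int[mu]_(x in V `&` A) D k x) @ U).

Let cvg_content A : measurable A ->
  (fun k => \int[mu]_(x in V `&` A) D k x) @ U --> weak_lim_content A.
Proof.
move=> mA; apply: (@ultrafilter_cvg _ _ _ (C * fine (mu (V `&` A)))) => k.
apply: le_Rintegral_bound => //; [exact: measurableI|exact: muVI|].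
by move=> x [Vx _]; exact: D_C.
Qed.

Let content_bound A : measurable A ->
  0 <= weak_lim_content A <= C * fine (mu (V `&` A)).
Proof.
move=> mA; apply/andP; split.
  apply: (cvgr_to_ge (cvg_content mA)).
  apply: nearW => k; apply: Rintegral_ge0 => x [Vx _].
  by case/andP: (D0C k Vx).
apply: (cvgr_to_le (cvg_content mA)).
apply: nearW => k; apply: le_trans (ler_norm _) _.
apply: le_Rintegral_bound => //; [exact: measurableI|exact: muVI|].
by move=> x [Vx _]; exact: D_C.
Qed.

Let contentU A B : measurable A -> measurable B -> [disjoint A & B] ->
  weak_lim_content (A `|` B) = weak_lim_content A + weak_lim_content B.
Proof.
move=> mA mB AB; apply: (@cvg_lim _ _ _ U) => //.
rewrite (_ : (fun k => _) = (fun k => \int[mu]_(x in V `&` A) D k x) \+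
    (fun k => \int[mu]_(x in V `&` B) D k x)); first by apply: cvgD; exact: cvg_content.
apply/funext => k /=; rewrite setIUr Rintegral_setU//.
- exact: measurableI.
- exact: measurableI.
- rewrite -setIUr; apply: (@bounded_integrable _ _ _ _ _ _ C).
  + by apply: measurableI => //; exact: measurableU.
  + by apply: muVI; exact: measurableU.
  + exact: mDI.
  + by move=> x [Vx _]; exact: D_C.
- by apply/disj_setPS => x [[_ Ax] [_ Bx]]; move/disj_setPS: AB; apply; split; [exact: Ax|].
Qed.

(** A measure has to be nonnegative on every set, while the limit is controlled on measurable sets
    only; hence the value 0 elsewhere. *)
Definition weak_lim_measure (A : set T) : \bar R :=
  if `[< measurable A >] then (weak_lim_content A)%:E else 0%E.

Let wlmE A : measurable A -> weak_lim_measure A = (weak_lim_content A)%:E.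
Proof. by move=> mA; rewrite /weak_lim_measure asboolT. Qed.

Let wlm_le A : measurable A -> (weak_lim_measure A <= C%:E * mu (V `&` A))%E.
Proof.
move=> mA; rewrite wlmE//.
rewrite -[X in (_ * X)%E]fineK ?ge0_fin_numE ?muVI//.
by rewrite -EFinM lee_fin; case/andP: (content_bound mA).
Qed.

Let wlm_ge0 A : (0 <= weak_lim_measure A)%E.
Proof.
rewrite /weak_lim_measure; case: asboolP => // mA.
by rewrite lee_fin; case/andP: (content_bound mA).
Qed.

Let wlm0 : weak_lim_measure set0 = 0%E.
Proof.
apply/eqP; rewrite eq_le wlm_ge0 andbT (le_trans (wlm_le measurable0))//.
by rewrite setI0 measure0 mule0.
Qed.

Let wlmU A B : measurable A -> measurable B -> [disjoint A & B] ->
  (weak_lim_measure (A `|` B) = weak_lim_measure A + weak_lim_measure B)%E.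
Proof.
move=> mA mB AB; rewrite !wlmE//; last exact: measurableU.
by rewrite contentU.
Qed.

Let wlm_bigU (F : nat -> set T) n : (forall i, measurable (F i)) -> trivIset setT F ->
  (\sum_(0 <= i < n) weak_lim_measure (F i) =
    weak_lim_measure (\big[setU/set0]_(0 <= i < n) F i))%E.
Proof.
move=> mF tF; elim: n => [|n ih]; first by rewrite !big_nil wlm0.
rewrite !big_nat_recr//= ih wlmU//; first exact: bigsetU_measurable.
rewrite big_mkord disj_set2E; apply/eqP; rewrite (@trivIset_bigsetUI _ xpredT)//.
by rewrite [X in trivIset X F](_ : _ = [set: nat])//; exact/seteqP.
Qed.

Let wlm_sigma_additive : semi_sigma_additive weak_lim_measure.
Proof.
move=> F mF tF mUF; set W := \bigcup_n F n.
pose S n := \big[setU/set0]_(0 <= i < n) F i.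
have mS n : measurable (S n) by exact: bigsetU_measurable.
have SW n : S n `<=` W.
  by rewrite /S big_mkord => x; rewrite -bigcup_mkord => -[i _ Fi]; exists i.
pose P n := W `\` S n.
have mP n : measurable (P n) by exact: measurableD.
have E n : (\sum_(0 <= i < n) weak_lim_measure (F i) =
    weak_lim_measure W - weak_lim_measure (P n))%E.
  have SP : [disjoint S n & P n] by apply/disj_setPS => x [Sx [_]].
  by rewrite wlm_bigU// -/(S n) -{1}(setDUK (SW n)) (wlmU (mS n) (mP n) SP) addeK// wlmE.
(* The tails [P n] decrease to the empty set inside [V], of finite measure, so their [mu]-measure
   tends to 0 and the domination passes this on to the limit. *)
have P0 : weak_lim_measure \o P @ \oo --> 0%E.
  apply: (@squeeze_cvge _ _ _ _ (cst 0%E) _ (fun n => C%:E * mu (V `&` P n))%E).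
  - by apply: nearW => n /=; rewrite wlm_ge0 wlm_le.
  - exact: cvg_cst.
  - rewrite -(mule0 C%:E); apply: cvgeZl => //.
    rewrite -(measure0 mu) (_ : set0 = \bigcap_n (V `&` P n)).
      apply: (@nonincreasing_cvg_mu _ _ _ mu (fun n => V `&` P n)).
      + exact: muVI.
      + by move=> n; exact: measurableI.
      + by apply: bigcap_measurable => // n _; exact: measurableI.
      + move=> m n mn; apply/subsetPset; apply: setIS; apply: setDS.
        by rewrite /S !big_mkord; exact: subset_bigsetU.
    apply/seteqP; split => // x cap.
    (* [S n] collects the indices below [n], so a point of [F i] is excluded by [P i.+1]. *)
    have [_ [[i _ Fi] _]] := cap 0%N I.
    have [_ [_]] := cap i.+1 I; apply.
    by rewrite /S big_mkord -bigcup_mkord; exists i => //=.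
have -> : (fun n => \sum_(0 <= i < n) weak_lim_measure (F i))%E =
    (fun n => weak_lim_measure W - weak_lim_measure (P n))%E by apply/funext => n; exact: E.
have := cvgeB _ (cvg_cst (weak_lim_measure W)) P0.
by rewrite sube0; apply; rewrite oppe0 fin_num_adde_defl.
Qed.

HB.instance Definition _ := isMeasure.Build _ _ _ weak_lim_measure
  wlm0 wlm_ge0 wlm_sigma_additive.

Let wlm_fin : fin_num_fun weak_lim_measure.
Proof. by move=> A mA; rewrite wlmE. Qed.

HB.instance Definition _ := @Measure_isFinite.Build _ _ _ weak_lim_measure wlm_fin.

Let wlm_mass A : measurable A -> (weak_lim_measure A <= C%:E * mu A)%E.
Proof.
move=> mA; apply: (le_trans (wlm_le mA)); rewrite lee_wpmul2l//.
by apply: le_measure; rewrite ?inE//; exact: measurableI.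
Qed.

Lemma weak_lim_density : exists F : T -> R,
  [/\ measurable_fun setT F, forall x, 0 <= F x <= C &
    forall A, measurable A ->
      (fun k => \int[mu]_(x in V `&` A) D k x) @ U --> \int[mu]_(x in V `&` A) F x].
Proof.
have [F [mF F0C wlmF]] := @bounded_radon_nikodym _ _ _ mu weak_lim_measure C C0 wlm_mass.
exists F; split => // A mA.
have mVA : measurable (V `&` A) by exact: measurableI.
have /= wF := wlmF _ mVA.
rewrite /Rintegral.
rewrite -wF wlmE//=.
have := cvg_content mVA.
by rewrite setIA setIid.
Qed.

End weak_sequential_limit.

Section weak_lim_integral.
Import HBSimple.
Context d (T : measurableType d) (R : realType)
  (mu : {sigma_finite_measure set T -> \bar R}) (V : set T) (C : R)
  (D : nat -> T -> R).
Hypothesis mV : measurable V.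
Hypothesis muV : (mu V < +oo)%E.
Hypothesis C0 : 0 <= C.
Hypothesis mD : forall k, measurable_fun V (D k).
Hypothesis D0C : forall k x, V x -> 0 <= D k x <= C.

(** Convergence along the ultrafilter is known on indicators, passes to simple functions by
    linearity, and to bounded [phi] by L^1 approximation, since all densities share the bound
    [C]. *)
Lemma weak_star_cluster : exists F : T -> R,
  [/\ measurable_fun setT F, forall x, 0 <= F x <= C &
    forall (phi : T -> R) (K l : R), measurable_fun V phi ->
      (forall x, V x -> `|phi x| <= K) ->
      (fun k => \int[mu]_(x in V) (D k x * phi x)) @ \oo --> l ->
      \int[mu]_(x in V) (F x * phi x) = l].
Proof.
have [U [UU ooU]] := ultraFilterLemma eventually_filter.
have [F [mF F0C cF]] := weak_lim_density mV muV C0 mD D0C UU.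
exists F; split => // phi K l mphi phiK cl.
have D_C k x : V x -> `|D k x| <= C by move=> /(D0C k)/andP[D0 DC]; rewrite ger0_norm.
have F_C x : `|F x| <= C by have /andP[D0 DC] := F0C x; rewrite ger0_norm.
have mFV : measurable_fun V F by exact: measurable_funTS.
have intphi := bounded_integrable mV muV mphi phiK.
have intM (G : T -> R) (h : T -> R) : measurable_fun V G -> (forall x, V x -> `|G x| <= C) ->
    mu.-integrable V (EFin \o h) -> mu.-integrable V (EFin \o (fun x => G x * h x)).
  move=> mG GC /[dup] inth /integrableP[/measurable_EFinP mh _].
  apply: (@le_integrable _ _ _ mu V mV _ (EFin \o (fun x => C * h x))).
  - by apply/measurable_EFinP; exact: measurable_funM.
  - move=> x Vx /=; rewrite lee_fin !normrM (ger0_norm C0) ler_wpM2r//; exact: GC.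
  - by rewrite (_ : _ \o _ = (fun x => C%:E * (h x)%:E)%E)//; exact: integrableZl.
pose W (h : T -> R) :=
  (fun k => \int[mu]_(x in V) (D k x * h x)) @ U --> \int[mu]_(x in V) (F x * h x).
have W1 A : measurable A -> W \1_A.
  move=> mA; have E (G : T -> R) :
      \int[mu]_(x in V) (G x * \1_A x) = \int[mu]_(x in V `&` A) G x.
    rewrite Rintegral_mkcondr; apply: eq_Rintegral => x _.
    by rewrite patchE indicE; case: ifP => _; rewrite ?mulr1 ?mulr0.
  by rewrite /W; under eq_fun do rewrite E; rewrite E; exact: cF.
have WZ y (h : T -> R) : mu.-integrable V (EFin \o h) -> W h -> W (fun x => y * h x).
  move=> inth Wh.
  have E (G : T -> R) : measurable_fun V G -> (forall x, V x -> `|G x| <= C) ->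
      \int[mu]_(x in V) (G x * (y * h x)) = y * \int[mu]_(x in V) (G x * h x).
    move=> mG GC; rewrite -RintegralZl//; last exact: intM.
    by apply: eq_Rintegral => x _; rewrite mulrCA.
  rewrite /W E// (_ : (fun k => _) = (fun k => y * \int[mu]_(x in V) (D k x * h x))).
    by apply: cvgM Wh; exact: cvg_cst.
  by apply/funext => k; rewrite E//; exact: D_C.
have WD (h1 h2 : T -> R) : mu.-integrable V (EFin \o h1) -> mu.-integrable V (EFin \o h2) ->
    W h1 -> W h2 -> W (fun x => h1 x + h2 x).
  move=> inth1 inth2 Wh1 Wh2.
  have E (G : T -> R) : measurable_fun V G -> (forall x, V x -> `|G x| <= C) ->
      \int[mu]_(x in V) (G x * (h1 x + h2 x)) =
      \int[mu]_(x in V) (G x * h1 x) + \int[mu]_(x in V) (G x * h2 x).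
    move=> mG GC; rewrite -RintegralD//; [|exact: intM|exact: intM].
    by apply: eq_Rintegral => x _; rewrite mulrDr.
  rewrite /W E// (_ : (fun k => _) = (fun k =>
    \int[mu]_(x in V) (D k x * h1 x) + \int[mu]_(x in V) (D k x * h2 x))); first exact: cvgD.
  by apply/funext => k; rewrite E//; exact: D_C.
have int1 A : measurable A -> mu.-integrable V (EFin \o \1_A).
  move=> mA; apply: (@bounded_integrable _ _ _ _ _ _ 1) => //.
  by move=> x _; rewrite indicE; case: (x \in A); rewrite ?normr1 ?normr0.
have intZ y (h : T -> R) : mu.-integrable V (EFin \o h) ->
    mu.-integrable V (EFin \o (fun x => y * h x)).
  move=> inth; rewrite (_ : _ \o _ = (fun x => y%:E * (EFin \o h) x)%E)//; exact: integrableZl.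
have Wsum (A : R -> set T) (s : seq R) : (forall y, measurable (A y)) ->
    mu.-integrable V (EFin \o (fun x => \sum_(y <- s) y * \1_(A y) x)) /\
    W (fun x => \sum_(y <- s) y * \1_(A y) x).
  move=> mA; elim: s => [|y s [ints Ws]].
    rewrite (_ : (fun x => _) = (fun x => 0 * \1_setT x)); last first.
      by apply/funext => x; rewrite big_nil mul0r.
    by split; [apply: intZ; exact: int1|apply: WZ; [exact: int1|exact: W1]].
  rewrite (_ : (fun x => _) = (fun x => y * \1_(A y) x + \sum_(y <- s) y * \1_(A y) x)); last first.
    by apply/funext => x; rewrite big_cons.
  have i1 := intZ y _ (int1 _ (mA y)).
  split; last by apply: WD => //; apply: WZ; [exact: int1|exact: W1].
  pose h1 := EFin \o (fun x => y * \1_(A y) x).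
  pose h2 := EFin \o (fun x => \sum_(y <- s) y * \1_(A y) x).
  rewrite (_ : _ \o _ = h1 \+ h2)%E//.
  exact: integrableD.
have Wsfun (h : {sfun T >-> R}) : W h.
  have -> : (h : T -> R) = (fun x =>
      \sum_(y <- finmap.enum_fset (fset_set (range h))) y * \1_(h @^-1` [set y]) x).
    by apply/funext => x; rewrite fimfunE fsbig_finite.
  by apply: (Wsum (fun y => h @^-1` [set y]) _ _).2 => y; exact: measurable_funPTI.
(* The ultrafilter refines [\oo], so the integrals tend to [l] along it as well, and limits are
   unique. *)
suff Wphi : W phi.
  apply: (cvg_unique _ Wphi) => //.
  by apply: cvg_trans cl => P; exact: ooU.
have [g_ [intg _ cg]] := approximation_sfun_integrable mV intphi.
apply/cvgrPdist_lt => e e0.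
have C1 : 0 < C + 1 by rewrite ltr_wpDl.
(* Replacing [phi] by [g_ n] must cost at most [e / 4] against any density bounded by [C]; dividing
   by [C + 1] also covers [C = 0]. The remaining [e / 2] is spent on the convergence for the simple
   function. *)
have [n hn] : exists n, (\int[mu]_(z in V) `|(phi z)%:E - (g_ n z)%:E| < (e / 4 / (C + 1))%:E)%E.
  have ee : 0 < e / 4 / (C + 1) by rewrite !divr_gt0.
  move/fine_cvgP : cg => [[N1 _ cg1] /cvgrPdist_lt/(_ _ ee)[N2 _ cg2]].
  exists (maxn N1 N2); have := cg2 (maxn N1 N2) (leq_maxr _ _).
  rewrite /= sub0r normrN; have := cg1 (maxn N1 N2) (leq_maxl _ _) => /= fn.
  by rewrite -lte_fin -fine_abse// fineK ?abse_fin_num//; apply: le_lt_trans; exact: lee_abs.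
set g := g_ n in hn; have {}intg := intg n.
have intd : mu.-integrable V (EFin \o (fun x => phi x - g x)).
  by rewrite (_ : _ \o _ = (EFin \o phi) \- (EFin \o g))%E//; exact: integrableB.
have key (G : T -> R) : measurable_fun V G -> (forall x, V x -> `|G x| <= C) ->
    `|\int[mu]_(x in V) (G x * phi x) - \int[mu]_(x in V) (G x * g x)| <= e / 4.
  move=> mG GC; rewrite -RintegralB//; [|exact: intM|exact: intM].
  have intG := intM _ _ mG GC intd.
  under eq_Rintegral do rewrite -mulrBr.
  apply: le_trans (le_normr_Rintegral mV intG) _.
  apply: (@le_trans _ _ (\int[mu]_(x in V) (C * `|phi x - g x|))).
    apply: le_Rintegral => //; [exact: integrable_norm|apply: intZ; exact: integrable_norm|].
    by move=> x Vx; rewrite normrM ler_wpM2r//; exact: GC.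
  rewrite RintegralZl//; last exact: integrable_norm.
  have : \int[mu]_(x in V) `|phi x - g x| <= e / 4 / (C + 1).
    rewrite -lee_fin /Rintegral fineK; first exact: ltW.
    apply: integrable_fin_num => //; exact: integrable_norm.
  move=> /(ler_wpM2l C0) /le_trans; apply.
  rewrite mulrCA ler_piMr//; first by rewrite divr_ge0// ltW.
  by rewrite ler_pdivrMr// mul1r lerDl.
have e2 : 0 < e / 2 by rewrite divr_gt0.
have /cvgrPdist_lt/(_ _ e2) := Wsfun g.
apply: filterS => k hk.
have kF := key F mFV (fun x _ => F_C x).
have kD := key (D k) (mD k) (D_C k).
rewrite distrC in kD.
set a := \int[mu]_(x in V) (F x * phi x) in kF *.
set b := \int[mu]_(x in V) (F x * g x) in kF hk.
set a' := \int[mu]_(x in V) (D k x * phi x) in kD *.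
set b' := \int[mu]_(x in V) (D k x * g x) in kD hk.
rewrite (_ : a - a' = (a - b) + (b - b') + (b' - a')); last by ring.
rewrite (le_lt_trans (ler_normD _ _))//.
rewrite (_ : e = (e / 4 + e / 2) + e / 4); last by field.
by apply: ltr_leD => //; rewrite (le_lt_trans (ler_normD _ _))//; apply: ler_ltD.
Qed.

End weak_lim_integral.

(** * Weak derivatives of Lipschitz functions *)

Section difference_quotients.
Context d (T : measurableType d) (R : realType)
  (mu : {sigma_finite_measure set T -> \bar R}) (V : set T) (u : T -> R)
  (B M : R) (t : nat -> R) (tau sigma : nat -> T -> T).
Hypothesis mV : measurable V.
Hypothesis muV : (mu V < +oo)%E.
Hypothesis mu_u : measurable_fun V u.
Hypothesis uB : forall x, V x -> `|u x| <= B.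
Hypothesis M0 : 0 <= M.
Hypothesis t0 : forall k, 0 < t k.
Hypothesis mtau : forall k, measurable_fun setT (tau k).
Hypothesis msigma : forall k, measurable_fun setT (sigma k).
Hypothesis tauK : forall k, cancel (tau k) (sigma k).
Hypothesis int_tau : forall k (f : T -> \bar R), mu.-integrable setT f ->
  (\int[mu]_x f (tau k x) = \int[mu]_x f x)%E.
Hypothesis uM : forall k x, V x -> V (tau k x) -> `|u (tau k x) - u x| <= M * t k.

Let intV (f : T -> R) (C : R) : measurable_fun V f -> (forall x, V x -> `|f x| <= C) ->
  mu.-integrable V (EFin \o f).
Proof. exact: bounded_integrable. Qed.

Let intZ c (f : T -> R) : mu.-integrable V (EFin \o f) ->
  mu.-integrable V (EFin \o (fun x => c * f x)).
Proof.
move=> intf; rewrite (_ : _ \o _ = (fun x => c%:E * (EFin \o f) x)%E)//.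
exact: integrableZl.
Qed.

Let intB (f g : T -> R) : mu.-integrable V (EFin \o f) ->
  mu.-integrable V (EFin \o g) -> mu.-integrable V (EFin \o (fun x => f x - g x)).
Proof.
move=> intf intg; rewrite (_ : _ \o _ = (EFin \o f) \- (EFin \o g))%E//.
exact: integrableB.
Qed.

(** One [g], chosen before [phi], serves every test function. Of translations only this is kept:
    [tau k] preserves integrals, [sigma k] undoes it, and [u] changes by at most [M * t k] along
    it. *)
Lemma weak_difference_quotient : exists g : T -> R,
  [/\ measurable_fun V g, forall x, `|g x| <= M &
    forall (phi dphi : T -> R) (C C' : R),
      measurable_fun setT phi -> (forall x, `|phi x| <= C) ->
      (forall x, ~ V x -> phi x = 0) ->
      measurable_fun setT dphi ->
      (\forall k \near \oo, forall x, phi x != 0 -> V (tau k x)) ->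
      (forall k x, `|phi (sigma k x) - phi x| <= C' * t k) ->
      (forall x, (fun k => (phi (sigma k x) - phi x) / t k) @ \oo --> - dphi x) ->
      \int[mu]_(x in V) (u x * dphi x) = - \int[mu]_(x in V) (g x * phi x)].
Proof.
pose W k := V `&` tau k @^-1` V.
have mW k : measurable (W k).
  by apply: measurableI => //; rewrite -[X in measurable X]setTI; exact: mtau.
pose ut := u \_ V.
have mut : measurable_fun setT ut by exact/(measurable_restrictT _ mV).1.
(* The Lipschitz bound needs [x] and [tau k x] both in [V]; elsewhere the quotient is set to 0.
   Adding [M] puts the values into [0, 2M]. *)
pose D k x : R := ((fun x => ut (tau k x) - ut x) \_ (W k)) x / t k + M.
have mD k : measurable_fun V (D k).
  apply: measurable_funTS; apply: measurable_funD => //; apply: measurable_funM => //.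
  apply/(measurable_restrictT _ (mW k)).1.
  by apply: measurable_funTS; apply: measurable_funB => //; exact: measurableT_comp.
have utV x : V x -> ut x = u x by move=> Vx; rewrite /ut patchE mem_set.
have utNV x : ~ V x -> ut x = 0 by move=> Vx; rewrite /ut patchE memNset.
have D0M k x : V x -> 0 <= D k x <= 2 * M.
  move=> Vx; rewrite /D patchE; case: ifPn => [/set_mem[_ /= VW]|_]; last first.
    by rewrite mul0r add0r M0/= ler_peMl// ler1n.
  rewrite !utV//.
  have : `|(u (tau k x) - u x) / t k| <= M.
    by rewrite normrM normfV (gtr0_norm (t0 k)) ler_pdivrMr// uM.
  by rewrite ler_norml => /andP[q1 q2]; apply/andP; split; lra.
have C0 : 0 <= 2 * M by rewrite mulr_ge0.
have [F [mF F0M HF]] := weak_star_cluster mV muV C0 mD D0M.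
pose g x := F x - M.
have mg : measurable_fun V g.
  by apply: measurable_funTS; exact: measurable_funB.
have gM x : `|g x| <= M.
  by have /andP[F0 FM] := F0M x; rewrite ler_norml /g; apply/andP; split; lra.
exists g; split => // phi dphi C C' mphi phiC phi0 mdphi nphi bphi cphi.
have mphiV : measurable_fun V phi by exact: measurable_funTS.
have iphi : mu.-integrable V (EFin \o phi) by exact: (intV (C := C)).
have mps k : measurable_fun setT (phi \o sigma k) by exact: measurableT_comp.
have ups k : mu.-integrable V (EFin \o (fun x => u x * phi (sigma k x))).
  apply: (intV (C := B * C)).
    by apply: measurable_funM => //; apply: measurable_funTS; exact: mps.
  by move=> x Vx; rewrite normrM ler_pM//; exact: uB.
have uphi : mu.-integrable V (EFin \o (fun x => u x * phi x)).
  apply: (intV (C := B * C)); first exact: measurable_funM.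
  by move=> x Vx; rewrite normrM ler_pM//; exact: uB.
pose psi k x : R := (phi (sigma k x) - phi x) / t k.
(* Discrete integration by parts, valid once [tau k] keeps the support of [phi] inside [V]: then the
   cut-off to [W k] is invisible to [phi]. *)
have parts k : (forall x, phi x != 0 -> V (tau k x)) -> \int[mu]_(x in V) (D k x * phi x) =
    \int[mu]_(x in V) (u x * psi k x) + M * \int[mu]_(x in V) phi x.
  move=> tk.
  pose G x := ut x * phi (sigma k x).
  have GE : G = (fun x => u x * phi (sigma k x)) \_ V.
    by apply/funext => x; rewrite /G /ut !patchE; case: ifP => // _; rewrite mul0r.
  have iG : mu.-integrable setT (EFin \o G).
    rewrite GE -restrict_EFin; exact/(integrable_mkcond _ mV).1.
  (* Invariance is applied to [G]: composing it with [tau k] turns [phi (sigma k x)] back into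
     [phi x]. *)
  have E1 : \int[mu]_(x in V) (ut (tau k x) * phi x) = \int[mu]_(x in V) (u x * phi (sigma k x)).
    rewrite [RHS]Rintegral_mkcond -GE Rintegral_mkcond /Rintegral.
    rewrite -(int_tau k iG); congr fine; apply: eq_integral => x _.
    rewrite patchE /= /G tauK; case: ifPn => // /negP xV.
    by rewrite phi0 ?mulr0// => Vx; apply: xV; rewrite inE.
  have itau : mu.-integrable V (EFin \o (fun x => ut (tau k x) * phi x)).
    apply: (intV (C := (`|B| * C))).
      by apply: measurable_funTS; apply: measurable_funM => //; exact: measurableT_comp.
    move=> x Vx; rewrite normrM ler_pM//.
    have [Vt|nVt] := pselect (V (tau k x)); last by rewrite utNV// normr0.
    by rewrite utV// (le_trans (uB Vt))// ler_norm.
  transitivity (\int[mu]_(x in V) ((t k)^-1 * (ut (tau k x) * phi x - u x * phi x) + M * phi x)).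
    apply: eq_Rintegral => x /set_mem Vx; rewrite /D patchE mulrDl; congr (_ + _).
    have [phix0|phix] := eqVneq (phi x) 0; first by rewrite phix0 !mulr0 subrr mulr0.
    rewrite mem_set; last by split => //; exact: tk.
    by rewrite (utV _ Vx) -mulrBl mulrAC mulrC.
  have iB : mu.-integrable V (EFin \o (fun x => ut (tau k x) * phi x - u x * phi x)).
    exact: intB.
  rewrite RintegralD//; last 2 first.
  - exact: intZ.
  - exact: intZ.
  rewrite RintegralZl// RintegralZl//; congr (_ + _).
  rewrite RintegralB// E1 -RintegralB// -RintegralZl//; last first.
    exact: intB.
  by apply: eq_Rintegral => x _; rewrite /psi -mulrBr mulrCA [(t k)^-1 * _]mulrC.
have psiC' k x : `|psi k x| <= C'.
  by rewrite /psi normrM normfV (gtr0_norm (t0 k)) ler_pdivrMr.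
have mpsi k : measurable_fun V (psi k).
  apply: measurable_funTS; apply: measurable_funM => //; apply: measurable_funB => //.
  exact: mps.
have dphiC' x : `|dphi x| <= C'.
  rewrite -normrN; apply: (cvgr_to_le (cvg_norm (cphi x))).
  by apply: nearW => k; exact: psiC'.
have cv : (fun k => \int[mu]_(x in V) (u x * psi k x)) @ \oo -->
    \int[mu]_(x in V) (u x * - dphi x).
  have mN : measurable_fun V (fun x => u x * - dphi x).
    by apply: measurable_funM => //; apply: measurable_funTS; exact: measurableT_comp.
  have iN : mu.-integrable V (EFin \o (fun x => u x * - dphi x)).
    apply: (intV (C := B * C')) => // x Vx.
    by rewrite normrM normrN ler_pM//; exact: uB.
  have [] := @dominated_convergence _ _ _ mu V mV
    (fun k x => (u x * psi k x)%:E) (fun x => (u x * - dphi x)%:E) (cst (B * C')%:E).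
  - by move=> k; apply/measurable_EFinP; exact: measurable_funM.
  - exact/measurable_EFinP.
  - apply: aeW => x Vx; apply: cvg_EFin; first exact: nearW.
    by apply: cvgM; [exact: cvg_cst|exact: cphi].
  - apply: (intV (C := `|B * C'|)) => //.
  - apply: aeW => x k Vx; rewrite /= lee_fin normrM ler_pM//; exact: uB.
  move=> _ _; rewrite -(fineK (integrable_fin_num mV iN)) => /fine_cvg.
  exact.
pose I := \int[mu]_(x in V) (u x * - dphi x).
have cl : (fun k => \int[mu]_(x in V) (D k x * phi x)) @ \oo -->
    I + M * \int[mu]_(x in V) phi x.
  have : (fun k => \int[mu]_(x in V) (u x * psi k x) + M * \int[mu]_(x in V) phi x) @ \oo -->
    I + M * \int[mu]_(x in V) phi x by apply: cvgD => //; exact: cvg_cst.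
  apply: cvg_trans; apply: near_eq_cvg; apply: filterS nphi => k tk.
  by rewrite parts.
have FI := HF phi C _ mphiV (fun x _ => phiC x) cl.
have iF : mu.-integrable V (EFin \o (fun x => F x * phi x)).
  apply: (intV (C := 2 * M * C)); first by apply: measurable_funM => //; exact: measurable_funTS.
  move=> x _; rewrite normrM ler_pM//; have /andP[F0 FM] := F0M x; by rewrite ger0_norm.
have gI : \int[mu]_(x in V) (g x * phi x) = I.
  transitivity (\int[mu]_(x in V) (F x * phi x - M * phi x)).
    by apply: eq_Rintegral => x _; rewrite /g mulrBl.
  rewrite RintegralB//; last exact: intZ.
  by rewrite FI RintegralZl// addrK.
rewrite gI /I.
have iud : mu.-integrable V (EFin \o (fun x => u x * dphi x)).
  apply: (intV (C := B * C')).
    by apply: measurable_funM => //; exact: measurable_funTS.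
  by move=> x Vx; rewrite normrM ler_pM//; exact: uB.
transitivity (- (-1 * \int[mu]_(x in V) (u x * dphi x))); first by rewrite mulN1r opprK.
rewrite -RintegralZl//; congr (- _); apply: eq_Rintegral => x _.
by rewrite mulN1r mulrN.
Qed.

End difference_quotients.

Lemma bounded_Lnorm_lty d (T : measurableType d) (R : realType)
    (mu : {measure set T -> \bar R}) (p : R) (V : set T) (f : T -> R) (B : R) :
  0 < p -> (mu V < +oo)%E -> measurable V -> measurable_fun V f ->
  (forall x, V x -> `|f x| <= B) -> ('N[mu]_(p%:E) [EFin \o (f \_ V)] < +oo)%E.
Proof.
move=> p0 Vfin mV mf fB; rewrite unlock; apply: poweR_lty.
(* The absolute value matters when [V] is empty, as [B] may then be negative. *)
apply: (@le_lt_trans _ _ (\int[mu]_(x in V) (`|B| `^ p)%:E)%E).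
  rewrite [leRHS]integral_mkcond; apply: ge0_le_integral => //.
  - by move=> x _; exact: poweR_ge0.
  - apply: (measurableT_comp (measurable_poweR p)).
    apply: measurableT_comp => //; apply/measurable_EFinP.
    exact/(measurable_restrictT _ mV).1.
  - exact/(measurable_restrictT _ mV).1.
  - move=> x _ /=; rewrite !patchE; case: ifPn => [/set_mem Vx|_].
      rewrite lee_fin; apply: ge0_ler_powR; rewrite ?nnegrE//; first exact: ltW.
      exact: le_trans (fB _ Vx) (ler_norm _).
    by change ((`|0 : R| `^ p)%:E <= 0)%E; rewrite normr0 powR0// gt_eqF.
by rewrite integral_cst// lte_mul_pinfty.
Qed.

(** * Sigma-finiteness and topological preliminaries on R^n *)

Section lebesgue_sigma_finite.
Context {R : realType} (n : nat).
Local Notation L := (lebesgue_rV_type R n).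
Local Notation leb := (lebesgue_rV R n).

Lemma lebesgue_rV_sigma_finite : sigma_finite setT leb.
Proof.
exists (fun k : nat => ball (0 : 'rV[R]_n) k.+1%:R).
  apply/seteqP; split => // x _; exists (Num.truncn `|x|) => //=.
  by rewrite mx_norm_ball /ball_/= sub0r normrN truncnS_gt.
move=> k; split.
  by apply: borel_lebesgue_measurable; exact: measurable_ball_rV.
by rewrite lebesgue_ball ?ltry.
Qed.

HB.instance Definition _ := @Measure_isSigmaFinite.Build _ _ _
  (@completed_measure_extension _ _ _ (@borel_lebesgue_rV R n)) lebesgue_rV_sigma_finite.

(** The measure [lebesgue_rV] again, packaged with the sigma-finiteness that Radon-Nikodym asks
    for. *)
Definition sigma_finite_lebesgue_rV : {sigma_finite_measure set L -> \bar R} :=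
  @completed_measure_extension _ _ _ (@borel_lebesgue_rV R n).

End lebesgue_sigma_finite.

Section topology_rV.
Context {R : realType} (n : nat).
Local Notation E := 'rV[R]_n.
Local Notation L := (lebesgue_rV_type R n).
Local Notation leb := (lebesgue_rV R n).

(** Around each point of [K] half of an available radius goes to the point and half to the
    displacement; compactness makes the displacement bound uniform. *)
Lemma compact_open_margin (K V : set E) : compact K -> open V -> K `<=` V ->
  exists2 e : R, 0 < e & forall x h, K x -> `|h| < e -> V (x + h).
Proof.
move=> cK oV KV.
have /compact_near_coveringP cov := cK.
have H : nbhs (0 : E) [set h | K `<=` (fun x => V (x + h))].
  apply: (cov _ (nbhs (0 : E)) (fun h x => V (x + h))) => x Kx.
  have /nbhs_ballP[e /= e0 eV] : nbhs x V by apply: open_nbhs_nbhs; split => //; exact: KV.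
  have e2 : 0 < e / 2 by rewrite divr_gt0.
  exists (ball x (e / 2), ball (0 : E) (e / 2)).
    by split; apply: nbhsx_ballx.
  move=> [x' h] /= []; rewrite !mx_norm_ball /ball_/= sub0r normrN => bx bh.
  apply: eV; rewrite mx_norm_ball /ball_/= opprD addrA (splitr e).
  by rewrite (le_lt_trans (ler_normB _ _))// ltrD.
have /nbhs_ballP[e /= e0 He] := H.
exists e => // x h Kx he.
by apply: (He h) => //; rewrite mx_norm_ball /ball_/= sub0r normrN.
Qed.

Lemma continuous_measurable (f : E -> R) : continuous f ->
  measurable_fun (setT : set L) (f : L -> R).
Proof.
move=> cf mT; apply: (measurability _ (RGenOInfty.measurableE R)) => //.
move=> _ [_ [a ->] <-].
rewrite setTI; apply: open_lebesgue_measurable.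
by apply: open_comp => [x _|]; [exact: cf|exact: interval_open].
Qed.

Lemma bounded_in_Lp (p : R) (V : set E) (f : E -> R) (B : R) :
  0 < p -> (leb V < +oo)%E -> measurable (V : set L) ->
  measurable_fun (V : set L) (f : L -> R) ->
  (forall x, V x -> `|f x| <= B) -> in_Lp p%:E V f.
Proof. by move=> p0 Vfin mV mf fB; split => //; exact: (bounded_Lnorm_lty p0 Vfin mV mf fB). Qed.

End topology_rV.

(** * Coordinate difference quotients and weak partial derivatives *)

Section weak_derivative.
Context {R : realType} (n : nat) (i : 'I_n).
Local Notation E := 'rV[R]_n.
Local Notation L := (lebesgue_rV_type R n).
Local Notation leb := (lebesgue_rV R n).
Let e : E := delta_mx ord0 i.

Lemma norm_delta_mx_le1 : `|e| <= 1.
Proof.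
have -> : `|e| = mx_norm e by [].
rewrite mx_normrE; apply/bigmax_leP; split => // ij _.
by rewrite mxE; case: (_ && _); rewrite ?normr1 ?normr0.
Qed.

Lemma partial_mvt (phi : E -> R) (C : R) :
  (forall x, derivable phi x e) -> (forall x, `|partial i phi x| <= C) ->
  forall x t, 0 < t -> `|phi (x - t *: e) - phi x| <= C * t.
Proof.
move=> dphi bphi x t t0; pose y := x - t *: e; pose f (s : R) := phi (y + s *: e).
(* The difference quotients of [f] at [s] are literally those of [phi] along [e] at [y + s *: e]. *)
have df (s : R) : is_derive s 1 f (partial i phi (y + s *: e)).
  have F : (fun h : R => h^-1 *: ((f \o shift s) (h *: 1) - f s)) =
    (fun h : R => h^-1 *: ((phi \o shift (y + s *: e)) (h *: e) - phi (y + s *: e))).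
    apply/funext => h /=; rewrite /f; congr (_ *: (phi _ - _)).
    by rewrite scaler1 scalerDl addrCA.
  by constructor; rewrite /derivable /partial /derive F//; exact: dphi.
have [c _] := @MVT_segment R f (fun s => partial i phi (y + s *: e)) 0 t (ltW t0)
  (fun s _ => df s) (continuous_subspaceT (fun s => differentiable_continuous
     ((derivable1_diffP _ _).1 (@ex_derive _ _ _ _ _ _ _ (df s))))).
rewrite /f scale0r addr0 subr0 /y subrK => ft.
by rewrite distrC ft normrM (gtr0_norm t0) ler_wpM2r// ltW.
Qed.

(** The increments [- t k] tend to 0 without vanishing; dividing by [t k] instead of [- t k]
    accounts for the sign of the limit. *)
Lemma cvg_difference_quotient (phi : E -> R) (x : E) (t : nat -> R) :
  (forall k, 0 < t k) -> t @ \oo --> 0 -> derivable phi x e ->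
  (fun k => (phi (x - t k *: e) - phi x) / t k) @ \oo --> - partial i phi x.
Proof.
move=> t0 ct dphi.
have ct' : (fun k => - t k) @ \oo --> (0 : R)^'.
  move=> P /nbhs_ballP[d /= d0 dP].
  have /cvgrPdist_lt/(_ _ d0) := ct; apply: filterS => k /=.
  rewrite sub0r normrN => tk; apply: dP; last by rewrite oppr_eq0 gt_eqF.
  by rewrite /ball/= sub0r opprK.
have := cvg_comp _ _ ct' dphi.
rewrite -/(derive phi x e) => /cvgN.
apply: cvg_trans; apply: near_eq_cvg; apply: nearW => k /=.
rewrite [LHS](_ : _ = - ((- t k)^-1 * (phi (- t k *: e + x) - phi x)))//.
by rewrite invrN mulNr opprK mulrC scaleNr (addrC x).
Qed.

Lemma compact_support_bounded (K : set E) (f : E -> R) : compact K -> continuous f ->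
  (forall x, ~ K x -> f x = 0) -> exists2 C, 0 <= C & forall x, `|f x| <= C.
Proof.
move=> cK cf f0.
have /compact_bounded[M [_ Mf]] : compact (f @` K).
  by apply: continuous_compact => //; exact: continuous_subspaceT.
exists (`|M| + 1); first by rewrite addr_ge0.
move=> x; have [Kx|nKx] := pselect (K x); last by rewrite f0// normr0 addr_ge0.
by apply: Mf; [rewrite (le_lt_trans (ler_norm M))// ltrDl|exists x].
Qed.

Lemma test_functionP (V : set E) (phi : E -> R) : test_function V phi ->
  let S := closure [set x | phi x != 0] in
  [/\ compact S, S `<=` V, continuous phi, forall x, ~ S x -> phi x = 0 &
    [/\ continuous (partial i phi), forall x, derivable phi x e &
      forall x, ~ S x -> partial i phi x = 0]].
Proof.
move=> [sphi [cS SV]] S.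
have S0 x : ~ S x -> phi x = 0.
  by move=> nSx; apply/eqP/negPn/negP => phix; apply: nSx; exact: subset_closure.
split => //; first by have [] := sphi [::].
split; first by have [] := sphi [:: i].
  by move=> x; have [_] := sphi [::]; exact.
move=> x nSx; rewrite /partial.
(* The complement of the support is open, so [phi] vanishes near [x] and not just at [x]. *)
have : \forall y \near x, phi y = cst 0 y.
  have nS : nbhs x (~` S).
    by apply: open_nbhs_nbhs; split => //; apply: closed_openC; exact: closed_closure.
  by apply: filterS nS => y nSy; rewrite S0.
by move=> /near_eq_derive ->; rewrite derive_cst.
Qed.

Lemma lipschitz_weak_partial (V : set E) (u : E -> R) (B M dl p : R) :
  open V -> (leb V < +oo)%E -> measurable_fun (V : set L) (u : L -> R) ->
  (forall x, V x -> `|u x| <= B) -> 0 < dl -> 0 <= M ->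
  (forall x h, V x -> V (x + h) -> `|h| < dl -> `|u (x + h) - u x| <= M * `|h|) ->
  0 < p -> exists2 g, in_Lp p%:E V g & weak_partial i V u g.
Proof.
move=> oV Vfin mu uB dl0 M0 uM p0.
have mV : measurable (V : set L) by exact: open_lebesgue_measurable.
(* With [k.+2] every step, including the one for [k = 0], is strictly shorter than [dl]. *)
pose t (k : nat) : R := dl / k.+2%:R.
have t0 k : 0 < t k by rewrite divr_gt0.
have tdl k : t k < dl by rewrite ltr_pdivrMr// ltr_pMr// ltr1n.
have ct : t @ \oo --> 0.
  rewrite -(mulr0 dl); apply: cvgMr.
  by have := @cvg_harmonic R; rewrite -cvg_shiftS.
have eh k : `|t k *: e| <= t k.
  by rewrite normrZ (gtr0_norm (t0 k)) ler_piMr ?norm_delta_mx_le1// ltW.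
pose tau k : L -> L := translate (t k *: e).
pose sigma k : L -> L := translate (- (t k *: e)).
have mtau k : measurable_fun setT (tau k) by exact: measurable_fun_translate.
have msigma k : measurable_fun setT (sigma k) by exact: measurable_fun_translate.
have tauK k : cancel (tau k) (sigma k) by move=> x; rewrite /sigma /tau /translate addrK.
have int_tau k (f : L -> \bar R) : leb.-integrable setT f ->
    (\int[leb]_x f (tau k x) = \int[leb]_x f x)%E.
  by move=> /integrableP[mf _]; exact: integral_translate.
have uMt k x : V x -> V (tau k x) -> `|u (tau k x) - u x| <= M * t k.
  move=> Vx Vt; rewrite /tau /translate (le_trans (uM _ _ Vx Vt _))// ?(le_lt_trans (eh k))//.
  by rewrite ler_wpM2l.
have [g [mg gM Hg]] := @weak_difference_quotient _ L R (@sigma_finite_lebesgue_rV R n)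
  V u B M t tau sigma mV Vfin mu uB M0 t0 mtau msigma tauK int_tau uMt.
exists g; first exact: (bounded_in_Lp p0 Vfin mV mg (fun x _ => gM x)).
move=> phi /test_functionP[cS SV cphi phi0 [cdphi dphi dphi0]].
have [C C0 phiC] := compact_support_bounded cS cphi phi0.
have [C' C'0 dphiC] := compact_support_bounded cS cdphi dphi0.
have [eta eta0 He] := compact_open_margin cS oV SV.
apply: (Hg phi (partial i phi) C C').
- exact: continuous_measurable.
- exact: phiC.
- by move=> x nVx; apply: phi0 => /SV.
- exact: continuous_measurable.
- have /cvgrPdist_lt/(_ _ eta0) := ct; apply: filterS => k.
  rewrite sub0r normrN (gtr0_norm (t0 k)) => tk x phix; apply: He.
    exact: subset_closure.
  by rewrite (le_lt_trans (eh k)).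
- by move=> k x; exact: partial_mvt.
- by move=> x; exact: cvg_difference_quotient.
Qed.

End weak_derivative.

(** * Densities *)

Section set_function_integral.
Context d (T : measurableType d) (R : realType).
Import HBNNSimple.

(* [integral] only evaluates the set function on measurable sets, so that
   [nu] need not be a measure. *)
Lemma eq_set_function_integral (nu mu : set T -> \bar R) (D : set T) (f : T -> \bar R) :
  (forall A, measurable A -> nu A = mu A) ->
  integral nu D f = integral mu D f.
Proof.
move=> numu; rewrite /integral; congr (ereal_sup _ - ereal_sup _)%E;
  apply/eq_imagel => h _; rewrite /sintegral; apply: eq_fsbigr => x _;
  by rewrite numu.
Qed.

Lemma integrable_set_function (nu mu : set T -> \bar R) (D : set T) (f : T -> \bar R) :
  (forall A, measurable A -> nu A = mu A) ->
  nu.-integrable D f -> mu.-integrable D f.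
Proof.
move=> numu /integrableP[mf intf]; apply/integrableP; split => //.
by rewrite -(eq_set_function_integral _ _ numu).
Qed.

End set_function_integral.

Section density.
Context d (T : measurableType d) (R : realType) (mu : {measure set T -> \bar R})
  (f : T -> R) (mf : measurable_fun setT f) (f0 : forall x, 0 <= f x).
Local Open Scope ereal_scope.

(** The two proofs are arguments so that the measure structure, which rests on them, can be
    recovered from the term. *)
Definition density_measure of measurable_fun setT f & (forall x, (0 <= f x)%R) :=
  fun A : set T => \int[mu]_(x in A) (f x)%:E.
Local Notation nu := (density_measure mf f0).

Let nu0 : nu set0 = 0. Proof. exact: integral_set0. Qed.

Let nu_ge0 A : 0 <= nu A.
Proof. by apply: integral_ge0 => x _; rewrite lee_fin. Qed.

Let nu_sigma_additive : semi_sigma_additive nu.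
Proof.
apply: (@semi_sigma_additive_nng_induced _ _ _ mu (EFin \o f)).
  exact/measurable_EFinP.
by move=> x; rewrite lee_fin.
Qed.

HB.instance Definition _ := isMeasure.Build _ _ _ nu nu0 nu_ge0 nu_sigma_additive.

(** If the integral of [f] over [A] vanished, [f] would be 0 almost everywhere on [A] as well as
    positive there, making [A] null. *)
Lemma density_measure_gt0 (A : set T) : measurable A -> 0 < mu A ->
  {ae mu, forall x, A x -> (0 < f x)%R} -> 0 < nu A.
Proof.
move=> mA muA fpos; rewrite lt_neqAle nu_ge0 andbT eq_sym; apply/eqP => nuA0.
have mfA : measurable_fun A (EFin \o f).
  by apply/measurable_EFinP; exact: measurable_funTS.
have : ae_eq mu A (EFin \o f) (cst 0).
  apply/ae_eq_integral_abs => //; rewrite -nuA0; apply: eq_integral => x _ /=.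
  by rewrite ger0_norm.
move=> f0A; suff : mu A = 0 by move=> A0; rewrite A0 ltxx in muA.
apply/negligibleP => //.
have : \forall x \ae mu, ~ A x.
  apply: filterS2 fpos f0A => x h1 h2 Ax.
  by have := h1 Ax; have [->] := h2 Ax; rewrite ltxx.
by apply: negligibleS => x Ax; exact.
Qed.

Lemma density_measure_le (C : R) (A : set T) : measurable A ->
  (0 <= C)%R -> {ae mu, forall x, A x -> (f x <= C)%R} -> nu A <= C%:E * mu A.
Proof.
move=> mA C0 fC; rewrite -integral_cst//.
apply: ae_ge0_le_integral => //.
- by move=> x _; rewrite lee_fin.
- by apply/measurable_EFinP; exact: measurable_funTS.
Qed.

End density.

Section integral_difference.
Context d (T : measurableType d) (R : realType) (mu : {measure set T -> \bar R}).

(** The integrals over the common part cancel, leaving those over the two halves of the symmetric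
    difference. *)
Lemma Rintegral_set_difference (A B : set T) (u : T -> R) (M : R) :
  measurable A -> measurable B -> (mu A < +oo)%E -> (mu B < +oo)%E ->
  measurable_fun (A `|` B) u -> (forall x, (A `|` B) x -> `|u x| <= M) ->
  `|\int[mu]_(x in A) u x - \int[mu]_(x in B) u x| <=
  M * (fine (mu (A `\` B)) + fine (mu (B `\` A))).
Proof.
move=> mA mB Afin Bfin mu_ uM.
have sub D : D `<=` A `|` B -> measurable D -> (mu D < +oo)%E -> mu.-integrable D (EFin \o u).
  move=> DAB mD Dfin; apply: (bounded_integrable mD Dfin (C := M)).
    by apply: measurable_funS mu_ => //; exact: measurableU.
  by move=> x /DAB; exact: uM.
have finS D C : measurable D -> measurable C -> D `<=` C -> (mu C < +oo)%E -> (mu D < +oo)%E.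
  by move=> mD mC DC; apply: le_lt_trans; apply: le_measure; rewrite ?inE.
have mAB : measurable (A `\` B) by exact: measurableD.
have mBA : measurable (B `\` A) by exact: measurableD.
have split2 (D C : set T) : measurable D -> measurable C -> D `<=` A `|` B -> (mu D < +oo)%E ->
    \int[mu]_(x in D) u x = \int[mu]_(x in D `&` C) u x + \int[mu]_(x in D `\` C) u x.
  move=> mD mC DAB Dfin; rewrite -[in LHS](setUIDK D C) Rintegral_setU//.
  - exact: measurableI.
  - exact: measurableD.
  - by rewrite setUIDK; exact: sub.
  - by apply/disj_setPS => x [[_ ?] [_]].
rewrite (split2 A B)// (split2 B A)//.
rewrite (setIC B A) opprD addrACA subrr add0r mulrDr.
apply: le_trans (ler_normB _ _) _; apply: lerD.
- apply: le_Rintegral_bound => //.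
  + exact: (finS _ A).
  + by apply: measurable_funS mu_ => //; [exact: measurableU|move=> x []; left].
  + by move=> x [Ax _]; apply: uM; left.
- apply: le_Rintegral_bound => //.
  + exact: (finS _ B).
  + by apply: measurable_funS mu_ => //; [exact: measurableU|move=> x []; right].
  + by move=> x [Ax _]; apply: uM; right.
Qed.

Lemma subset_Rintegral (A B : set T) (f : T -> R) :
  measurable A -> measurable B -> A `<=` B -> (forall x, 0 <= f x) ->
  mu.-integrable B (EFin \o f) ->
  \int[mu]_(x in A) f x <= \int[mu]_(x in B) f x.
Proof.
move=> mA mB AB f0 intf; apply: fine_le.
- by apply: integrable_fin_num => //; exact: integrableS intf.
- exact: integrable_fin_num.
- apply: ge0_subset_integral => //; first by case/integrableP : intf.
  by move=> x _; rewrite lee_fin.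
Qed.

(** The norm of exponent [+oo] is an essential supremum only on a space of positive measure, hence
    the first hypothesis. *)
Lemma Linfty_ae_bound (A : set T) (f : T -> R) : (0 < mu setT)%E ->
  ('N[mu]_(+oo) [EFin \o (f \_ A)] < +oo)%E ->
  exists2 C : R, 0 <= C & {ae mu, forall x, A x -> `|f x| <= C}.
Proof.
rewrite unlock => -> Nfin.
have ge := ess_sup_ge mu (abse \o (EFin \o (f \_ A))).
move: Nfin ge; set N := ess_sup _ _ => Nfin ge.
exists (Num.max 0 (fine N)); first by rewrite le_max lexx.
apply: filterS ge => x + Ax; rewrite /= patchE mem_set// => fN.
rewrite le_max -[X in _ || X]lee_fin; apply/orP; right.
by rewrite (le_trans fN)//; move: Nfin fN; case: (N) => //= _; rewrite leeNy_eq.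
Qed.

End integral_difference.

(** * Norms and measures of their balls *)

Section norms.
Context {R : realType} (n : nat) (N : 'rV[R]_n -> R).
Local Notation E := 'rV[R]_n.
Hypothesis normN : is_norm N.

Lemma is_norm0 : N 0 = 0.
Proof. by case: normN => _ NZ _; rewrite -(scale0r 0) NZ normr0 mul0r. Qed.

Lemma is_normN x : N (- x) = N x.
Proof. by case: normN => _ NZ _; rewrite -scaleN1r NZ normrN1 mul1r. Qed.

Lemma is_norm_sub x y : N (x - y) = N (y - x).
Proof. by rewrite -is_normN opprB. Qed.

Lemma is_norm_ge0 x : 0 <= N x.
Proof.
case: normN => _ _ ND; have := ND x (- x).
by rewrite subrr is_norm0 is_normN -mulr2n pmulrn_lge0.
Qed.

Lemma is_norm_tri x y z : N (x - z) <= N (x - y) + N (y - z).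
Proof.
case: normN => _ _ ND; rewrite (_ : x - z = (x - y) + (y - z)) ?ND//.
by rewrite addrA subrK.
Qed.

Lemma is_norm_le_mx : exists2 c, 0 < c & forall x, N x <= c * `|x|.
Proof.
case: normN => _ NZ ND.
(* The summand 1 keeps the constant positive in dimension 0. *)
exists (1 + \sum_j N (delta_mx ord0 j)).
  by rewrite ltr_pwDl// sumr_ge0// => j _; exact: is_norm_ge0.
move=> x; apply: (@le_trans _ _ (\sum_j `|x| * N (delta_mx ord0 j))).
  rewrite {1}(row_sum_delta x); elim/big_rec2 : _ => [|j a b _ ab].
    by rewrite is_norm0.
  apply: le_trans (ND _ _) _; apply: lerD => //.
  rewrite NZ ler_wpM2r ?is_norm_ge0//.
  have -> : `|x| = mx_norm x by [].
  by rewrite mx_normrE; apply: (le_bigmax _ _ (ord0, j)).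
rewrite -mulr_sumr mulrC ler_wpM2r// lerDr//.
Qed.

Lemma is_norm_dist_continuous (x : E) : continuous (fun y : E => N (x - y)).
Proof.
have [c c0 Nc] := is_norm_le_mx.
move=> y; apply/(@cvgrPdist_lt _ _ _ (nbhs y) (nbhs_filter y)) => e e0.
have ec : 0 < e / c by rewrite divr_gt0.
apply/nbhs_ballP; exists (e / c) => // z.
rewrite mx_norm_ball /ball_/= => yz.
have h : `|N (x - y) - N (x - z)| <= N (y - z).
  have := is_norm_tri x y z; have := is_norm_tri x z y.
  by rewrite (is_norm_sub z y) ler_norml => h1 h2; apply/andP; split; lra.
rewrite (le_lt_trans h)// (le_lt_trans (Nc _))//.
by rewrite mulrC -ltr_pdivlMr.
Qed.

Lemma is_norm_continuous : continuous N.
Proof.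
have -> : N = (fun y => N (0 - y)) by apply/funext => y; rewrite sub0r is_normN.
exact: is_norm_dist_continuous.
Qed.

(** [N] is continuous and attains a positive minimum on the compact unit sphere of the sup norm;
    homogeneity does the rest. *)
Lemma mx_le_is_norm : exists2 c, 0 < c & forall x, `|x| <= c * N x.
Proof.
case: normN => Nx0 NZ ND.
pose S := [set x : E | `|x| = 1].
(* If the sphere is empty, 0 is the only vector and any constant serves. *)
have [S0|/set0P/negP/negPn/eqP S0] := pselect (S !=set0); last first.
  exists 1 => // x; have [->|x0] := eqVneq x 0.
    by rewrite normr0 mul1r is_norm_ge0.
  exfalso; suff : S (`|x|^-1 *: x) by rewrite S0.
  by rewrite /S /= normrZ normfV normr_id mulVf// normr_eq0.
have cS : compact S.
  apply: bounded_closed_compact.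
    by exists 1; split => // M M1 x /= xS; rewrite xS; exact: ltW.
  have -> : S = (fun x : E => `|x|) @^-1` [set 1] by [].
  by apply: closed_comp => [x _|]; [exact: norm_continuous|exact: closed_eq].
have [c cS' cmin] := compact_EVT_min S0 cS (continuous_subspaceT is_norm_continuous).
have {}cS' : `|c| = 1 by move: cS'; rewrite inE.
have Nc : 0 < N c.
  rewrite lt_neqAle is_norm_ge0 andbT eq_sym; apply/eqP => /Nx0 c0.
  by move: cS'; rewrite c0 normr0 => /esym/eqP; rewrite oner_eq0.
exists (N c)^-1; first by rewrite invr_gt0.
move=> x; have [->|x0] := eqVneq x 0.
  by rewrite normr0 mulr_ge0 ?is_norm_ge0// invr_ge0 ltW.
have nx : 0 < `|x| by rewrite normr_gt0.
have xS : `|x|^-1 *: x \in S.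
  by rewrite inE /S /= normrZ normfV normr_id mulVf// normr_eq0.
have := cmin _ xS.
rewrite NZ normfV normr_id ler_pdivlMl// => h.
by rewrite mulrC ler_pdivlMr.
Qed.

Lemma closed_norm_ball_compact x r : compact [set y | N (x - y) <= r].
Proof.
have [c c0 xc] := mx_le_is_norm.
apply: bounded_closed_compact.
  exists (`|x| + c * `|r|); split; first exact: num_real.
  move=> M rM y /= Nxy; apply/ltW; apply: le_lt_trans rM.
  rewrite -[y](subKr x) (le_trans (ler_normB _ _))// lerD2l (le_trans (xc _))//.
  by rewrite ler_pM2l// (le_trans Nxy)// ler_norm.
have -> : [set y | N (x - y) <= r] = (fun y => N (x - y)) @^-1` [set z | z <= r] by [].
apply: closed_comp => [y _|]; [exact: is_norm_dist_continuous|exact: closed_le].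
Qed.

Section norm_balls.
Variables (d : E -> E -> R) (dN : forall x y, d x y = N (x - y)).

Lemma open_mball x r : open (mball d x r).
Proof.
have -> : mball d x r = (fun y => N (x - y)) @^-1` [set z | z < r].
  by apply/seteqP; split => y; rewrite /mball /= dN.
apply: open_comp => [y _|]; [exact: is_norm_dist_continuous|exact: open_lt].
Qed.

Lemma mball_compactly_included x r x0 r0 (Om : set E) : N (x0 - x) + r <= r0 ->
  [set y | N (x0 - y) <= r0] `<=` Om -> compactly_included (mball d x r) Om.
Proof.
move=> rr0 KOm; pose K := [set y | N (x0 - y) <= r0].
have cK : compact K by exact: closed_norm_ball_compact.
have clK : closed K by apply: compact_closed => //; exact: norm_hausdorff.
have BK : closure (mball d x r) `<=` K.
  rewrite closureE => y; apply; split => // z; rewrite /mball/= dN => xz.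
  by rewrite /K/= (le_trans (is_norm_tri x0 x z))// (le_trans _ rr0)// lerD2l ltW.
split; last exact: subset_trans BK KOm.
by apply: subclosed_compact BK => //; exact: closed_closure.
Qed.

Lemma norm_ball_subset (Om : set E) x : open Om -> Om x ->
  exists2 r, 0 < r & [set y | N (x - y) <= r] `<=` Om.
Proof.
move=> oOm Omx; have [c c0 xc] := mx_le_is_norm.
have /nbhs_ballP[e /= e0 eOm] : nbhs x Om by exact: open_nbhs_nbhs.
(* Half of the radius [e / c]: a closed ball has to fit into an open one. *)
exists (e / (2 * c)); first by rewrite divr_gt0// mulr_gt0.
move=> y /= Nxy; apply: eOm; rewrite mx_norm_ball /ball_/=.
rewrite (le_lt_trans (xc _))// (le_lt_trans (ler_wpM2l (ltW c0) Nxy))//.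
rewrite (_ : c * _ = e / 2); last by field; rewrite gt_eqF.
by rewrite ltr_pdivrMr// ltr_pMr// ltr1n.
Qed.

Local Notation L := (lebesgue_rV_type R n).
Local Notation leb := (lebesgue_rV R n).

Lemma measurable_mball x r : measurable (mball d x r : set L).
Proof. by apply: open_lebesgue_measurable; exact: open_mball. Qed.

Lemma mball_lebesgue_lty x r : (leb (mball d x r) < +oo)%E.
Proof.
have cK := @closed_norm_ball_compact x r.
apply: le_lt_trans (compact_lebesgue_lty cK).
apply: le_measure; rewrite ?inE.
- exact: measurable_mball.
- by apply: closed_lebesgue_measurable; apply: compact_closed cK; exact: norm_hausdorff.
- by move=> y; rewrite /mball /= dN => /ltW.
Qed.

Lemma lebesgue_mball x r : leb (mball d x r) = leb (mball d 0 r).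
Proof.
rewrite -(lebesgue_translate (- x) (mball d 0 r)).
congr (leb _); apply/seteqP; split => z; rewrite /mball/= !dN /translate;
  by rewrite sub0r opprB.
Qed.

(* The sets B(x + kh) \ B(x + (k-1)h), with h = x - y, are translates of
   B(x) \ B(y); they are pairwise disjoint because balls are convex, and about
   1/N(h) of them fit in the ball of radius r + 1. *)
Lemma lebesgue_mball_difference x y r : N (x - y) <= 1 ->
  fine (leb (mball d x r `\` mball d y r)) <=
  2 * fine (leb (mball d 0 (r + 1))) * N (x - y).
Proof.
case: normN => Nx0 NZ ND; set h := x - y => Nh1.
have [h0|h0] := eqVneq h 0.
  have xy : x = y by apply/eqP; rewrite -subr_eq0 -/h h0.
  by rewrite h0 is_norm0 mulr0 xy setDv measure0.
have Nh0 : 0 < N h.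
  rewrite lt_neqAle is_norm_ge0 andbT eq_sym; apply/eqP => /Nx0.
  by move/eqP; rewrite (negbTE h0).
pose c k : E := x + k%:R *: h.
pose A k := mball d (c k) r `\` mball d (c k - h) r.
have A0 : A 0%N = mball d x r `\` mball d y r.
  by rewrite /A /c scale0r addr0 /h subKr.
have mA k : measurable (A k : set L).
  by apply: (@measurableD _ L); exact: measurable_mball.
have lA k : leb (A k) = leb (A 0%N).
  rewrite -(lebesgue_translate (- (k%:R *: h)) (A 0%N)).
  have e1 z : c 0%N - translate (- (k%:R *: h)) z = c k - z.
    by apply/rowP => j; rewrite /c /translate !mxE; ring.
  have e2 z : c 0%N - h - translate (- (k%:R *: h)) z = c k - h - z.
    by apply/rowP => j; rewrite /c /translate !mxE; ring.
  by congr (leb _); apply/seteqP; split => z; rewrite /A /mball/= !dN e1 e2.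
have dA : trivIset setT A.
  apply/ltn_trivIset => l k kl; apply/seteqP; split => // z [] [kz _] [lz lz'].
  apply: lz'; move: lz kz; rewrite /mball/= !dN => lz kz.
  pose s := (l - k.+1)%N.
  have ls : l%:R = k%:R + s%:R + 1 :> R.
    by rewrite -natrD natr1 /s addnC -addnS subnK.
  have s0 : 0 < s%:R + 1 :> R by rewrite ltr_wpDl.
  (* [c l - h] is a convex combination of [c k] and [c l]. A point in the balls around both is thus
     in the ball around [c l - h], which [A l] excludes. *)
  have conv : (s%:R + 1) *: (c l - h - z) = (c k - z) + s%:R *: (c l - z).
    by apply/rowP => j; rewrite /c ls !mxE; ring.
  rewrite -(ltr_pM2l s0) -{1}(gtr0_norm s0) -NZ conv.
  apply: (le_lt_trans (ND _ _)); rewrite NZ normr_nat mulrDl mul1r addrC.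
  by apply: ler_ltD => //; rewrite ler_wpM2l// ltW.
(* [m] is the integer part of 1/N(h), at least 1: [m] steps move the centre by at most 1, and 1/N(h)
   < m + 1 <= 2m yields the factor 2 of the estimate. *)
pose m := Num.truncn (N h)^-1.
have Nhv0 : 0 <= (N h)^-1 by rewrite invr_ge0 ltW.
have m1 : (0 < m)%N by rewrite truncn_ge_nat// -(invr1 R) lef_pV2 ?posrE.
have mle : m%:R * N h <= 1 by rewrite -ler_pdivlMr// mul1r truncn_le.
have mge : 1 <= 2 * m%:R * N h.
  rewrite -ler_pdivrMr// mul1r; apply: ltW; apply: lt_le_trans (truncnS_gt _) _.
  by rewrite -/m -natrM ler_nat mul2n -addnn -addn1 leq_add2l.
have AB k : (k < m)%N -> A k `<=` mball d x (r + 1).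
  move=> km z []; rewrite /mball/= !dN => kz _.
  apply: (le_lt_trans (is_norm_tri x (c k) z)); rewrite addrC; apply: ltr_leD => //.
  rewrite /c opprD addrA subrr sub0r is_normN NZ normr_nat.
  by apply: le_trans mle; rewrite ler_wpM2r ?ler_nat ?is_norm_ge0// ltnW.
have sumA : (\sum_(k < m) leb (A k) <= leb (mball d x (r + 1)))%E.
  rewrite -(@measure_bigsetU _ _ _ leb A mA dA m); apply: le_measure; rewrite ?inE.
  - by apply: (@bigsetU_measurable _ L) => k _; exact: mA.
  - exact: measurable_mball.
  - rewrite -bigcup_mkord => z [k /= km]; exact: AB.
have fA0 : leb (A 0%N) \is a fin_num.
  rewrite ge0_fin_numE//; apply: le_lt_trans (mball_lebesgue_lty x r).
  apply: le_measure; rewrite ?inE; [exact: mA|exact: measurable_mball|].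
  by rewrite A0 => z [].
have fB : leb (mball d 0 (r + 1)) \is a fin_num.
  by rewrite ge0_fin_numE//; exact: mball_lebesgue_lty.
move: sumA; rewrite lebesgue_mball (eq_bigr (fun=> leb (A 0%N)))//.
rewrite -(fineK fA0) -(fineK fB) sumEFin big_const_ord iter_addr_0 lee_fin -A0.
set a := fine _; set K0 := fine _ => ma.
have a0 : 0 <= a by exact: fine_ge0.
apply: (@le_trans _ _ (2 * m%:R * N h * a)).
  by rewrite ler_peMl.
rewrite -mulr_natl in ma.
rewrite (_ : 2 * m%:R * N h * a = 2 * (m%:R * a) * N h); last by ring.
by rewrite ler_wpM2r ?is_norm_ge0// ler_wpM2l.
Qed.

End norm_balls.
End norms.

(** * Regularity of strongly harmonic functions *)

Section positive_part_density.
Context d (T : measurableType d) (R : realType) (mu : {measure set T -> \bar R})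
  (Om : set T) (w : T -> R).
Hypothesis mOm : measurable Om.
Hypothesis mw : measurable_fun Om w.

(** A version of [w] that is nonnegative and measurable everywhere, hence the density of a true
    measure; it agrees with [w] wherever [w] is positive on [Om]. *)
Definition restrict_pos : T -> R := (fun x => Num.max (w x) 0) \_ Om.

Lemma restrict_pos_ge0 x : 0 <= restrict_pos x.
Proof.
rewrite /restrict_pos patchE; case: ifP => _; first by rewrite le_max lexx orbT.
exact: lexx.
Qed.

Lemma measurable_restrict_pos : measurable_fun setT restrict_pos.
Proof. by apply/(measurable_restrictT _ mOm).1; exact: measurable_maxr. Qed.

Lemma restrict_posE x : Om x -> 0 < w x -> restrict_pos x = w x.
Proof. by move=> Omx wx; rewrite /restrict_pos patchE mem_set// max_l// ltW. Qed.

Lemma integral_restrict_pos A : measurable A -> {ae mu, forall x, Om x -> 0 < w x} ->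
  (\int[mu]_(x in A `&` Om) (w x)%:E =
    density_measure mu measurable_restrict_pos restrict_pos_ge0 A)%E.
Proof.
move=> mA wpos; rewrite /density_measure.
have mAO : measurable (A `&` Om) by exact: measurableI.
have mwA : measurable_fun (A `&` Om) w by apply: measurable_funS mw => // x [].
transitivity (\int[mu]_(x in A `&` Om) (Num.max (w x) 0)%:E)%E.
  apply: ae_eq_integral => //.
  - exact/measurable_EFinP.
  - by apply/measurable_EFinP; exact: measurable_maxr.
  - by apply: filterS wpos => x wx [_ Omx]; rewrite max_l// ltW// wx.
rewrite integral_mkcondr; apply: eq_integral => x _.
by rewrite /restrict_pos !patchE; case: ifP.
Qed.

Lemma ae_restrict_pos_gt0 A : A `<=` Om -> {ae mu, forall x, Om x -> 0 < w x} ->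
  {ae mu, forall x, A x -> 0 < restrict_pos x}.
Proof. by move=> AOm; apply: filterS => x wx /AOm Omx; rewrite restrict_posE ?wx. Qed.

Lemma ae_restrict_pos_le A C : A `<=` Om -> {ae mu, forall x, Om x -> 0 < w x} ->
  {ae mu, forall x, A x -> `|w x| <= C} ->
  {ae mu, forall x, A x -> restrict_pos x <= C}.
Proof.
move=> AOm; apply: filterS2 => x wx wC Ax; have Omx := AOm _ Ax.
by rewrite restrict_posE ?wx// (le_trans (ler_norm _))// wC.
Qed.

Lemma ae_subset (P : T -> Prop) (A B : set T) : A `<=` B ->
  {ae mu, forall x, B x -> P x} -> {ae mu, forall x, A x -> P x}.
Proof. by move=> AB; apply: filterS => x Px /AB. Qed.

End positive_part_density.

(** From (x - y) a = (F - G) - y (a - b). It will be used with [a], [b] the masses of two balls,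
    [F], [G] the integrals of [u] over them and [x], [y] the mean values. *)
Lemma quotient_difference_le (R : realFieldType) (a b c x y M S F G : R) :
  0 < c -> c <= a -> `|y| <= M -> x * a = F -> y * b = G ->
  `|F - G| <= M * S -> `|a - b| <= S -> `|x - y| * c <= 2 * M * S.
Proof.
move=> c0 ca yM <- <- FG ab.
apply: (@le_trans _ _ (`|x - y| * a)); first by rewrite ler_wpM2l.
rewrite -{1}(gtr0_norm (lt_le_trans c0 ca)) -normrM.
rewrite (_ : (x - y) * a = (x * a - y * b) - y * (a - b)); last by ring.
apply: le_trans (ler_normB _ _) _; rewrite normrM.
rewrite (_ : 2 * M * S = M * S + M * S); last by ring.
by apply: lerD => //; exact: ler_pM.
Qed.

(** * Mean values over balls and the local Lipschitz estimate *)

Section harmonic.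
Context {R : realType} (n : nat) (Om : set 'rV[R]_n) (N : 'rV[R]_n -> R)
  (d : 'rV[R]_n -> 'rV[R]_n -> R) (w u : 'rV[R]_n -> R).
Local Notation E := 'rV[R]_n.
Local Notation L := (lebesgue_rV_type R n).
Local Notation leb := (lebesgue_rV R n).
Hypothesis oOm : open Om.
Hypothesis normN : is_norm N.
Hypothesis dN : forall x y, d x y = N (x - y).
Hypothesis mw : measurable_fun (Om : set L) (w : L -> R).
Hypothesis wpos : {ae leb, forall x, Om x -> 0 < w x}.
Hypothesis wLoo : in_Lp_loc +oo%E Om w.
Hypothesis hu : strongly_harmonic Om d w u.

Let mOm : measurable (Om : set L). Proof. exact: open_lebesgue_measurable. Qed.

Let m : {measure set L -> \bar R} :=
  density_measure leb (measurable_restrict_pos mOm mw) (restrict_pos_ge0 _ _).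

Let weightedE (A : set L) : measurable A -> weighted w Om A = m A.
Proof. by move=> mA; exact: (integral_restrict_pos mOm mw mA wpos). Qed.

Let u_integrable (K : set E) : compact K -> K `<=` Om ->
  m.-integrable (K : set L) (EFin \o (u : L -> R)).
Proof.
move=> cK KOm; have [[_ /(_ K cK KOm) intw] _] := hu.
exact: (integrable_set_function weightedE intw).
Qed.

Let compact_measurable (K : set E) : compact K -> measurable (K : set L).
Proof.
by move=> cK; apply: closed_lebesgue_measurable; apply: compact_closed cK; exact: norm_hausdorff.
Qed.

Let weight_bound (K : set E) : compact K -> K `<=` Om -> exists2 C : R, 0 <= C &
  forall A : set L, measurable A -> A `<=` K -> (m A <= C%:E * leb A)%E.
Proof.
move=> cK KOm; have [_ Nfin] := wLoo cK KOm.
have lebT : (0 < leb setT)%E.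
  by apply: open_lebesgue_gt0; [exact: openT|exists 0].
have [C C0 wC] := Linfty_ae_bound lebT Nfin.
exists C => // A mA AK; apply: density_measure_le => //.
apply: ae_restrict_pos_le => //; first exact: subset_trans AK KOm.
exact: ae_subset AK wC.
Qed.

Let weight_gt0 (U : set E) : open U -> U !=set0 -> U `<=` Om -> (0 < m U)%E.
Proof.
move=> oU U0 UOm; apply: density_measure_gt0.
- exact: open_lebesgue_measurable.
- exact: open_lebesgue_gt0.
- exact: ae_restrict_pos_gt0.
Qed.

(** The mass is positive and finite, so the inverse in the extended reals is a true one and can be
    cleared. *)
Let mean_value x r : 0 < r -> compactly_included (mball d x r) Om ->
  (m (mball d x r) < +oo)%E ->
  u x * fine (m (mball d x r)) = \int[m]_(y in (mball d x r : set L)) u y.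
Proof.
move=> r0 BOm mfin; have [_ /(_ x r r0 BOm)] := hu.
have mB : measurable (mball d x r : set L) by exact: (measurable_mball normN dN).
rewrite (weightedE mB) (eq_set_function_integral _ _ weightedE).
have mpos : (0 < m (mball d x r))%E.
  apply: weight_gt0; [exact: (open_mball normN dN)|exists x|].
    by rewrite /mball/= dN subrr is_norm0.
  by have [_] := BOm; apply: subset_trans; exact: subset_closure.
have intB : m.-integrable (mball d x r : set L) (EFin \o (u : L -> R)).
  have [cB BO] := BOm; apply: integrableS (u_integrable cB BO) => //.
    exact: compact_measurable.
  exact: subset_closure.
rewrite -(fineK (integrable_fin_num mB intB)).
have mfn : m (mball d x r) \is a fin_num by rewrite ge0_fin_numE.
rewrite -(fineK mfn).
have b0 : fine (m (mball d x r)) != 0 by rewrite gt_eqF// fine_gt0// mpos.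
rewrite inver (negbTE b0) -EFinM => -[->] /=.
by rewrite mulrAC mulVf// mul1r.
Qed.

Lemma strongly_harmonic_locally_lipschitz x0 : Om x0 ->
  exists2 e : R, 0 < e & exists c : R, forall x y, ball x0 e x -> ball x0 e y ->
    `|u x| <= c /\ `|u x - u y| <= c * `|x - y|.
Proof.
move=> Omx0; have [r1 r10 KOm] := norm_ball_subset normN oOm Omx0.
set K := [set y | N (x0 - y) <= r1] in KOm.
have cK : compact K by exact: closed_norm_ball_compact.
(* Balls of radius [2 * rho] centred within [rho] of [x0] then stay inside [K]; [rho <= 1] supplies
   the closeness that [lebesgue_mball_difference] demands. *)
pose rho := Num.min (r1 / 4) 1.
have rho0 : 0 < rho by rewrite lt_min divr_gt0/=.
have rho1 : rho <= 1 by rewrite ge_min lexx orbT.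
have rhor1 : 4 * rho <= r1.
  have : rho <= r1 / 4 by rewrite ge_min lexx.
  by lra.
have [La La0 mLa] := weight_bound cK KOm.
have mmB x r : measurable (mball d x r : set L) by exact: (measurable_mball normN dN).
have lfin x r : (leb (mball d x r) < +oo)%E by exact: (mball_lebesgue_lty normN dN).
have BK x r : N (x0 - x) + r <= r1 -> mball d x r `<=` K.
  move=> h y; rewrite /mball/= dN /K/= => xy.
  by have := is_norm_tri normN x0 x y; lra.
have mfin x r : N (x0 - x) + r <= r1 -> (m (mball d x r) < +oo)%E.
  move=> /BK h; apply: (le_lt_trans (mLa _ (mmB x r) h)).
  by rewrite lte_mul_pinfty// ?lee_fin//.
have mfn x r : N (x0 - x) + r <= r1 -> m (mball d x r) \is a fin_num.
  by move=> h; rewrite ge0_fin_numE//; exact: mfin.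
have mv x r : 0 < r -> N (x0 - x) + r <= r1 ->
    u x * fine (m (mball d x r)) = \int[m]_(y in (mball d x r : set L)) u y.
  move=> r0 h; apply: mean_value => //; last exact: mfin.
  exact: (mball_compactly_included normN dN h KOm).
have mle x r x' r' : N (x0 - x) + r <= r1 -> N (x0 - x') + r' <= r1 ->
    mball d x r `<=` mball d x' r' -> fine (m (mball d x r)) <= fine (m (mball d x' r')).
  by move=> h h' sub; apply: fine_le; [exact: mfn|exact: mfn|apply: le_measure; rewrite ?inE].
have mpos r : 0 < r -> r <= r1 -> 0 < fine (m (mball d x0 r)).
  move=> r0 rr1; have h : N (x0 - x0) + r <= r1 by rewrite subrr is_norm0// add0r.
  rewrite fine_gt0// mfin// andbT; apply: weight_gt0.
  - exact: (open_mball normN dN).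
  - by exists x0; rewrite /mball/= dN subrr is_norm0.
  - exact: subset_trans (BK _ _ h) KOm.
have N00 : N (x0 - x0) = 0 by rewrite subrr is_norm0.
pose I := \int[m]_(y in (K : set L)) `|u y|.
(* [mball d x (2 * rho)] contains [mball d x0 rho], whose mass does not depend on [x], and lies in
   [K]; its mean value is therefore at most this quotient. *)
pose Mu := I / fine (m (mball d x0 rho)).
have uMu x : N (x0 - x) <= rho -> `|u x| <= Mu.
  move=> x0x; have h : N (x0 - x) + 2 * rho <= r1 by lra.
  have p0 : 0 < fine (m (mball d x0 rho)) by apply: mpos => //; lra.
  rewrite /Mu ler_pdivlMr//.
  have le0 : fine (m (mball d x0 rho)) <= fine (m (mball d x (2 * rho))).
    apply: mle => //; first by rewrite N00; lra.
    move=> y; rewrite /mball/= !dN => x0y.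
    by have := is_norm_tri normN x x0 y; rewrite (is_norm_sub normN x x0); lra.
  apply: (le_trans (ler_wpM2l (normr_ge0 _) le0)).
  rewrite -{1}(ger0_norm (fine_ge0 (measure_ge0 m (mball d x (2 * rho))))) -normrM.
  rewrite mv//; last by rewrite mulr_gt0.
  have intK := u_integrable cK KOm.
  have intB : m.-integrable (mball d x (2 * rho) : set L) (EFin \o (u : L -> R)).
    apply: integrableS intK => //; first exact: compact_measurable.
    exact: BK.
  apply: (le_trans (le_normr_Rintegral (mmB _ _) intB)).
  apply: (subset_Rintegral (mmB _ _) (compact_measurable cK) (BK _ _ h)) => //.
  exact: integrable_norm.
pose K0 := fine (leb (mball d 0 (rho / 2 + 1))).
(* Lower bound for the mass of [mball d x (rho / 2)], uniform in [x] within [rho / 4] of [x0]. *)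
pose m1 := fine (m (mball d x0 (rho / 4))).
have m10 : 0 < m1 by apply: mpos; lra.
have K00 : 0 <= K0 by exact: fine_ge0.
have Mu0 : 0 <= Mu by rewrite (le_trans _ (uMu x0 _))// N00 ltW.
(* Each half of the symmetric difference has [m]-mass at most 2 La K0 N(x - y); two halves, and the
   factor 2 Mu of [quotient_difference_le], give 8. *)
have key x y : N (x0 - x) <= rho / 4 -> N (x0 - y) <= rho / 4 ->
    `|u x - u y| <= 8 * Mu * La * K0 / m1 * N (x - y).
  move=> xB yB; set r := rho / 2 in K0 K00 *.
  have r0 : 0 < r by rewrite divr_gt0.
  have rr : r = rho / 2 by [].
  have Nxy : N (x - y) <= 1.
    by have := is_norm_tri normN x x0 y; rewrite (is_norm_sub normN x x0); lra.
  have Nyx : N (y - x) <= 1 by rewrite (is_norm_sub normN).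
  have hx : N (x0 - x) + r <= r1 by lra.
  have hy : N (x0 - y) + r <= r1 by lra.
  set A := mball d x r; set B := mball d y r.
  have uy : `|u y| <= Mu by apply: uMu; lra.
  have bx1 : m1 <= fine (m A).
    apply: mle => //; first by rewrite N00; lra.
    move=> z; rewrite /A /mball /= !dN => zx.
    have := is_norm_tri normN x x0 z; rewrite (is_norm_sub normN x x0) => tri.
    by lra.
  have ABrho z : (A `|` B) z -> N (x0 - z) <= rho.
    rewrite /A /B /mball /= !dN => -[zx|zy].
      by have := is_norm_tri normN x0 x z; lra.
    by have := is_norm_tri normN x0 y z; lra.
  have ABM z : (A `|` B) z -> `|u z| <= Mu by move=> /ABrho; exact: uMu.
  have mAB : measurable_fun (A `|` B : set L) (u : L -> R).
    have [[mu_ _] _] := hu; apply: (measurable_funS mOm _ mu_).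
    by move=> z /ABrho zr; apply: KOm; rewrite /K/=; lra.
  have dF := Rintegral_set_difference (mmB x r) (mmB y r) (mfin _ _ hx) (mfin _ _ hy) mAB ABM.
  (* The masses are compared by the same estimate, applied to the constant function 1. *)
  have m1AB : measurable_fun (A `|` B : set L) (fun _ : L => 1 : R) by exact: measurable_cst.
  have n1 (z : L) : (A `|` B) z -> `|1 : R| <= 1 by rewrite normr1.
  have dW := Rintegral_set_difference (mmB x r) (mmB y r) (mfin _ _ hx) (mfin _ _ hy) m1AB n1.
  have mx' := Rintegral_cst m (mmB x r) 1.
  have my' := Rintegral_cst m (mmB y r) 1.
  rewrite mx' my' !mul1r in dW.
  have Ddiff x' y' : N (x0 - x') + r <= r1 -> N (x' - y') <= 1 ->
      fine (m (mball d x' r `\` mball d y' r)) <= La * (2 * K0 * N (x' - y')).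
    move=> h' N1.
    have mD : measurable (mball d x' r `\` mball d y' r : set L).
      by apply: (@measurableD _ L); exact: mmB.
    have DK : mball d x' r `\` mball d y' r `<=` K by move=> z [/(BK _ _ h')].
    have lD : (leb (mball d x' r `\` mball d y' r) < +oo)%E.
      apply: le_lt_trans (lfin x' r).
      by apply: le_measure; rewrite ?inE; [exact: mD|exact: mmB|move=> z []].
    apply: (@le_trans _ _ (La * fine (leb (mball d x' r `\` mball d y' r)))); last first.
      by rewrite ler_wpM2l//; exact: (lebesgue_mball_difference normN dN r N1).
    have lDfin : leb (mball d x' r `\` mball d y' r) \is a fin_num by rewrite ge0_fin_numE.
    rewrite -lee_fin EFinM (fineK lDfin) fineK; first exact: mLa.
    rewrite ge0_fin_numE//; apply: (le_lt_trans (mLa _ mD DK)).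
    by rewrite -(fineK lDfin) -EFinM ltry.
  have D1 := Ddiff x y hx Nxy; have D2 := Ddiff y x hy Nyx.
  rewrite (is_norm_sub normN y x) in D2.
  have ex := mv x r r0 hx; have ey := mv y r r0 hy.
  rewrite mulrAC ler_pdivlMr//.
  have := quotient_difference_le m10 bx1 uy ex ey dF dW.
  move=> /le_trans; apply.
  have S4 : fine (m (A `\` B)) + fine (m (B `\` A)) <= 4 * La * K0 * N (x - y).
    by apply: le_trans (lerD D1 D2) _; rewrite le_eqVlt; apply/orP; left; apply/eqP; ring.
  apply: le_trans (ler_wpM2l (mulr_ge0 (ler0n R 2) Mu0) S4) _.
  by rewrite le_eqVlt; apply/orP; left; apply/eqP; ring.
have [c1 c10 Nc1] := is_norm_le_mx normN.
(* A sup-norm ball of this radius lies in the [N]-ball of radius [rho / 4]. *)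
exists (rho / (4 * c1)); first by rewrite divr_gt0// mulr_gt0.
have Q1 : 0 <= 8 * Mu * La * K0 by do 3 apply: mulr_ge0 => //.
have Q0 : 0 <= 8 * Mu * La * K0 / m1 by exact: (divr_ge0 Q1 (ltW m10)).
(* The sum dominates both the bound of [u] and its Lipschitz constant for the sup norm. *)
exists (Mu + 8 * Mu * La * K0 / m1 * c1).
have inB z : ball x0 (rho / (4 * c1)) z -> N (x0 - z) <= rho / 4.
  rewrite mx_norm_ball /ball_/= => h; rewrite (le_trans (Nc1 _))//.
  rewrite (_ : rho / 4 = c1 * (rho / (4 * c1))); last by field; rewrite gt_eqF.
  by rewrite ler_wpM2l// ltW.
move=> x y /inB xB /inB yB; split.
  rewrite (le_trans (uMu _ _))//; first by lra.
  by rewrite lerDl mulr_ge0// ltW.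
apply: (le_trans (key _ _ xB yB)).
apply: (@le_trans _ _ (8 * Mu * La * K0 / m1 * (c1 * `|x - y|))).
  by rewrite ler_wpM2l.
by rewrite [leRHS]mulrDl -(mulrA _ c1) lerDr mulr_ge0.
Qed.

End harmonic.

(** A single [M] is the bound, the Lipschitz constant and the inverse of the admissible scale: all
    conditions weaken as [M] grows, so compactness applies along [+oo]. Only [x] has to lie in [K],
    not [x + h]. *)
Lemma compact_uniformly_lipschitz (R : realType) (n : nat) (K : set 'rV[R]_n)
    (u : 'rV[R]_n -> R) : compact K ->
  (forall x0, K x0 -> exists2 e : R, 0 < e & exists c : R,
    forall x y, ball x0 e x -> ball x0 e y ->
      `|u x| <= c /\ `|u x - u y| <= c * `|x - y|) ->
  exists2 M : R, 0 < M & forall x, K x -> `|u x| <= M /\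
    forall h, `|h| < M^-1 -> `|u (x + h) - u x| <= M * `|h|.
Proof.
move=> /compact_near_coveringP cK lipK.
have H : \forall M \near +oo, K `<=` (fun x => `|u x| <= M /\
    forall h, `|h| < M^-1 -> `|u (x + h) - u x| <= M * `|h|).
  apply: (cK _ (pinfty_nbhs R) (fun M x => `|u x| <= M /\
    forall h, `|h| < M^-1 -> `|u (x + h) - u x| <= M * `|h|)) => x0 Kx0.
  have [e e0 [c ue]] := lipK _ Kx0.
  have e2 : 0 < e / 2 by rewrite divr_gt0.
  (* Beyond this threshold [M] exceeds [c] and [M^-1] is below [e / 2], so [x + h] remains in
     [ball x0 e]. *)
  exists (ball x0 (e / 2), [set M | `|c| + 2 / e < M]).
    split; first exact: nbhsx_ballx.
    by exists (`|c| + 2 / e); split; [exact: num_real|].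
  move=> [x M] /= [x0x cM].
  have ec0 : 0 < 2 / e by rewrite divr_gt0.
  have M0 : 0 < M by rewrite (le_lt_trans _ cM)// addr_ge0// ltW.
  have cM' : c <= M.
    by rewrite (le_trans (ler_norm c))// (le_trans _ (ltW cM))// lerDl ltW.
  have x0x' : ball x0 e x.
    by apply: le_ball x0x; rewrite ler_pdivrMr// ler_pMr// ler1n.
  split; first by have [h _] := ue x x x0x' x0x'; exact: le_trans h cM'.
  move=> h hM.
  have he : `|h| < e / 2.
    rewrite (lt_trans hM)// -[e / 2]invrK invf_div ltf_pV2 ?posrE//.
    by rewrite (le_lt_trans _ cM)// lerDr.
  have x0xh : ball x0 e (x + h).
    move: x0x; rewrite !mx_norm_ball /ball_/= => x0x.
    by rewrite opprD addrA (splitr e) (le_lt_trans (ler_normB _ _))// ltrD.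
  have [_ ] := ue _ _ x0xh x0x'.
  rewrite (addrC x h) addrK => /le_trans; apply.
  by rewrite ler_wpM2r.
have [M0 [_ HM]] := H.
exists (`|M0| + 1); first by rewrite ltr_wpDl.
move=> x Kx; apply: HM => //.
by rewrite (le_lt_trans (ler_norm _))// ltrDl.
Qed.

Theorem proposition5 (R : realType) (n : nat) (Om : set 'rV[R]_n)
    (d : 'rV[R]_n -> 'rV[R]_n -> R) (w : 'rV[R]_n -> R) (p : R) :
  open Om ->
  norm_induced d ->
  locally_integrable_on (lebesgue_rV R n) Om w ->
  {ae lebesgue_rV R n, forall x, Om x -> 0 < w x} ->
  1 < p ->
  in_W1p_loc p%:E Om w ->
  in_Lp_loc +oo%E Om w ->
  strongly_harmonic Om d w `<=` [set u | in_W1p_loc p%:E Om u].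
Proof.
move=> oOm [N normN dN] [mw _] wpos p1 _ wLoo u hu V oV [cV VOm].
have p0 : 0 < p by rewrite (lt_trans ltr01).
(* Uniformity is drawn from the compact closure of [V], not from [V]; [M^-1] then serves as the
   scale of the Lipschitz bound. *)
have [M M0 uM] := compact_uniformly_lipschitz cV (fun x Kx =>
  strongly_harmonic_locally_lipschitz oOm normN dN mw wpos wLoo hu (VOm x Kx)).
have VK : V `<=` closure V by exact: subset_closure.
have mV : measurable (V : set (lebesgue_rV_type R n)) by exact: open_lebesgue_measurable.
have Vfin : (lebesgue_rV R n V < +oo)%E.
  apply: le_lt_trans (compact_lebesgue_lty cV).
  apply: le_measure; rewrite ?inE//.
  by apply: closed_lebesgue_measurable; exact: closed_closure.
have mu : measurable_fun (V : set (lebesgue_rV_type R n)) (u : lebesgue_rV_type R n -> R).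
  have [[mu _] _] := hu; apply: measurable_funS mu.
    exact: open_lebesgue_measurable.
  exact: subset_trans VK VOm.
have uB x : V x -> `|u x| <= M by move=> /VK/uM[].
split; first exact: (bounded_in_Lp p0 Vfin mV mu uB).
move=> i; have Mv0 : 0 < M^-1 by rewrite invr_gt0.
apply: (lipschitz_weak_partial i oV Vfin mu uB Mv0 (ltW M0) _ p0).
by move=> x h /VK/uM[_ uh] _; exact: uh.
Qed.
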